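(* Let $\mathcal{Z}$ denote the space $c_0$ equipped with the norm $\|x\|_{\mathcal{Z}}=\|x\|_\infty+\left(\sum_{i=1}^\infty \frac{|x(i)|^2}{2^i}\right)^{1/2}$, and let $X=c_0\oplus_\infty\mathcal{Z}$, i.e. $c_0\times\mathcal{Z}$ with norm $\|(y,z)\|=\max\{\|y\|_\infty,\|z\|_{\mathcal{Z}}\}$. Then the norm of $X$ is strongly subdifferentiable, and $X$ fails the $\mathbf{L}_{p,p}$-nu.
   Context: For a Banach space $X$ over $\mathbb{K}\in\{\mathbb{R},\mathbb{C}\}$: $\Pi(X)=\{(x,x^* )\in S_X\times S_{X^*}: x^*(x)=1\}$; for $T\in\mathcal{L}(X)$ (bounded linear operators on $X$), $v(T)=\sup\{|x^*(Tx)|:(x,x^* )\in\Pi(X)\}$. $X$ has the $\mathbf{L}_{p,p}$-nu if for every $\varepsilon>0$ and $(x,x^* )\in\Pi(X)$ there is $\eta(\varepsilon,(x,x^* ))>0$ such that whenever $T\in\mathcal{L}(X)$ with $v(T)=1$ satisfies $|x^*(Tx)|>1-\eta(\varepsilon,(x,x^* ))$, there is $S\in\mathcal{L}(X)$ with $v(S)=1$, $|x^*(Sx)|=1$ and $\|S-T\|<\varepsilon$. The norm of $X$ is strongly subdifferentiable if for every $x\in X$ the limit $\lim_{t\to0^+}\frac{\|x+th\|-\|x\|}{t}$ exists uniformly in $h\in B_X$. *)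

(* Defs.v *)
From Stdlib Require Import Reals.
From Coquelicot Require Import Coquelicot.
Open Scope R_scope.

Section Space.
Variable K : AbsRing.

(* Vectors of X = c_0 (+)_oo Z are pairs of scalar sequences, indexed from 0:
   index n corresponds to the paper's coordinate i = n+1. *)
Definition vec := ((nat -> K) * (nat -> K))%type.

Definition is_c0 (u : nat -> K) : Prop :=
  forall eps : R, 0 < eps -> exists N : nat, forall n, (N <= n)%nat -> abs (u n) < eps.

Definition inX (x : vec) : Prop := is_c0 (fst x) /\ is_c0 (snd x).

Definition supnorm (u : nat -> K) : R :=
  real (Lub_Rbar (fun r => exists n, r = abs (u n))).

Definition Znorm (z : nat -> K) : R :=
  supnorm z + sqrt (Series (fun n => (abs (z n)) ^ 2 / 2 ^ (S n))).

Definition nX (x : vec) : R := Rmax (supnorm (fst x)) (Znorm (snd x)).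

Definition vadd (x y : vec) : vec :=
  (fun n => plus (fst x n) (fst y n), fun n => plus (snd x n) (snd y n)).
Definition vscal (a : K) (x : vec) : vec :=
  (fun n => mult a (fst x n), fun n => mult a (snd x n)).
Definition vsub (x y : vec) : vec := vadd x (vscal (opp one) y).
(* real scalar multiple t*x, t : R, via the embedding ofR : R -> K (id or RtoC) *)
Definition vrscal (ofR : R -> K) (t : R) (x : vec) : vec := vscal (ofR t) x.

Definition is_op (T : vec -> vec) : Prop :=
  (forall x, inX x -> inX (T x)) /\
  (forall a x y, inX x -> inX y -> T (vadd (vscal a x) y) = vadd (vscal a (T x)) (T y)) /\
  (exists M : R, forall x, inX x -> nX (T x) <= M * nX x).

Definition is_lin_functional (f : vec -> K) : Prop :=
  forall a x y, inX x -> inX y -> f (vadd (vscal a x) y) = plus (mult a (f x)) (f y).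

Definition dual_norm_is (f : vec -> K) (c : R) : Prop :=
  is_lub (fun r => exists x, inX x /\ nX x <= 1 /\ r = abs (f x)) c.

Definition inPi (x : vec) (f : vec -> K) : Prop :=
  inX x /\ nX x = 1 /\ is_lin_functional f /\ dual_norm_is f 1 /\ f x = one.

Definition numrad_is (T : vec -> vec) (c : R) : Prop :=
  is_lub (fun r => exists x f, inPi x f /\ r = abs (f (T x))) c.

Definition opnorm_is (T : vec -> vec) (c : R) : Prop :=
  is_lub (fun r => exists x, inX x /\ nX x <= 1 /\ r = nX (T x)) c.

Definition Lpp_nu : Prop :=
  forall eps : R, 0 < eps ->
  forall x f, inPi x f ->
  exists eta : R, 0 < eta /\
    forall T, is_op T -> numrad_is T 1 -> abs (f (T x)) > 1 - eta ->
    exists S, is_op S /\ numrad_is S 1 /\ abs (f (S x)) = 1 /\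
      exists c, opnorm_is (fun y => vsub (S y) (T y)) c /\ c < eps.

Definition norm_SSD (ofR : R -> K) : Prop :=
  forall x, inX x ->
  exists D : vec -> R,
    forall eps : R, 0 < eps -> exists delta : R, 0 < delta /\
      forall h t, inX h -> nX h <= 1 -> 0 < t < delta ->
        Rabs ((nX (vadd x (vrscal ofR t h)) - nX x) / t - D h) < eps.

End Space.

(* Main.v *)
Require Import Defs.
From Stdlib Require Import Reals Lra Lia Classical FunctionalExtensionality.
From Coquelicot Require Import Coquelicot.

(* Strong subdifferentiability: uniform one-sided differentiability is stable under sums and finite maxima. Near a
   nonzero point the sup norm of c_0 is a maximum of finitely many moduli, and the weighted l_2 seminorm is the square
   root of a quadratic polynomial along lines.

   Failure of L_{p,p}-nu: let q = sqrt (1/2), z_0 = e_0 / (1 + q), x_0 = (e_0, z_0), and let x_0^* = (1 + q) e_0^* act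
   on the second summand. For T (y, z) = (0, (y_0 e_0 + sum_{m > n} y_m e_m) / v), with v chosen so that v(T) = 1,
   x_0^* (T x_0) = (1 + q) / v tends to 1 as n grows. Suppose that v(S) = 1 = |x_0^* (S x_0)|. For all small s and
   |th| <= 1 the point (e_0 + th e_{n+1}, z_s), with z_s the normalization of e_0 + s e_{n+1}, is supported by the
   derivative z_s^* of the norm of Z at z_s, whose coefficient at e_{n+1} has order s exactly. Since the numerical
   radius inequality |z_s^* (S (e_0 + th e_{n+1}, z_s))| <= 1 is an equality at s = th = 0, its first order part in s
   must vanish for every th, which forces the coefficient of S from e_{n+1} in c_0 to e_{n+1} in Z to be 0. The
   corresponding coefficient of T is 1 / v > 1/4, so S is not within 1/4 of T. *)

(** * Real and complex scalars under one interface *)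

(* [ip x y] stands for [Re (x * conj y)]. *)
Record real_or_complex (K : AbsRing) (ofR : R -> K) (ip : K -> K -> R) : Prop := {
  rc_comm : forall x y : K, mult x y = mult y x;
  rc_inv : forall x : K, x <> zero -> exists y : K, mult y x = one;
  rc_abs_mult : forall x y : K, abs (mult x y) = abs x * abs y;
  rc_ofR_one : ofR 1 = one;
  rc_ofR_plus : forall s t, ofR (s + t) = plus (ofR s) (ofR t);
  rc_ofR_mult : forall s t, ofR (s * t) = mult (ofR s) (ofR t);
  rc_abs_ofR : forall t, abs (ofR t) = Rabs t;
  rc_sq : forall (x y : K) t,
    abs (plus x (mult (ofR t) y)) ^ 2 = abs x ^ 2 + 2 * t * ip x y + t ^ 2 * abs y ^ 2
}.

Lemma real_real_or_complex : real_or_complex R_AbsRing (fun t : R => t) Rmult.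
Proof.
  split; unfold mult, plus, one, zero, abs; simpl; unfold mult, plus, one, zero, abs; simpl; intros.
  - apply Rmult_comm.
  - exists (/ x). field. exact H.
  - apply Rabs_mult.
  - reflexivity.
  - reflexivity.
  - reflexivity.
  - reflexivity.
  - generalize (pow2_abs (x + t * y)) (pow2_abs x) (pow2_abs y); simpl. nra.
Qed.

Lemma complex_real_or_complex :
  real_or_complex C_AbsRing RtoC (fun x y => Re x * Re y + Im x * Im y).
Proof.
  split; unfold mult, plus, one, zero, abs; simpl; unfold mult, plus, one, zero, abs; simpl; intros.
  - apply Cmult_comm.
  - exists (/ x)%C. apply Cinv_l. exact H.
  - apply Cmod_mult.
  - reflexivity.
  - apply RtoC_plus.
  - apply RtoC_mult.
  - apply Cmod_R.
  - generalize (Cmod2_alt (x + t * y)%C) (Cmod2_alt x) (Cmod2_alt y); simpl.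
    destruct x as [x1 x2], y as [y1 y2]; simpl. intros -> -> ->. ring.
Qed.

(** * Uniform one-sided differentiability *)

(* The bound on [D] makes [p t h] tend to [p0] uniformly in [h], as needed for maxima with [p0 <> q0]. *)
Definition unif_diff {V : Type} (B : V -> Prop) (p : R -> V -> R) (p0 : R) : Prop :=
  exists (D : V -> R) (L : R), (forall h, B h -> Rabs (D h) <= L) /\
    forall eps, 0 < eps -> exists delta, 0 < delta /\
      forall h t, B h -> 0 < t < delta -> Rabs ((p t h - p0) / t - D h) < eps.

Lemma unif_diff_eventually {V : Type} (B : V -> Prop) (p q : R -> V -> R) p0 d :
  0 < d -> (forall h t, B h -> 0 < t < d -> p t h = q t h) ->
  unif_diff B q p0 -> unif_diff B p p0.
Proof.
  intros Hd Hpq [D [L [HL H]]]. exists D, L. split; [exact HL|].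
  intros eps He. destruct (H eps He) as [d' [Hd' H']].
  exists (Rmin d d'). split; [now apply Rmin_pos|].
  intros h t Bh Ht. generalize (Rmin_l d d') (Rmin_r d d'); intros.
  rewrite Hpq by (trivial; lra). apply H'; trivial; lra.
Qed.

Lemma unif_diff_const {V : Type} (B : V -> Prop) c : unif_diff B (fun _ _ => c) c.
Proof.
  exists (fun _ => 0), 0. split.
  - intros. rewrite Rabs_R0. lra.
  - intros eps He. exists 1. split; [lra|]. intros h t _ Ht.
    replace ((c - c) / t - 0) with 0 by (field; lra). now rewrite Rabs_R0.
Qed.

Lemma unif_diff_plus {V : Type} (B : V -> Prop) p q p0 q0 :
  unif_diff B p p0 -> unif_diff B q q0 ->
  unif_diff B (fun t h => p t h + q t h) (p0 + q0).
Proof.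
  intros [D [L [HL H]]] [D' [L' [HL' H']]].
  exists (fun h => D h + D' h), (L + L'). split.
  - intros h Bh. eapply Rle_trans; [apply Rabs_triang|]. apply Rplus_le_compat; auto.
  - intros eps He. destruct (H (eps / 2)) as [d [Hd Hp]]; [lra|].
    destruct (H' (eps / 2)) as [d' [Hd' Hq]]; [lra|].
    exists (Rmin d d'). split; [now apply Rmin_pos|].
    intros h t Bh Ht. generalize (Rmin_l d d') (Rmin_r d d'); intros.
    replace ((p t h + q t h - (p0 + q0)) / t - (D h + D' h)) with
      (((p t h - p0) / t - D h) + ((q t h - q0) / t - D' h)) by (field; lra).
    eapply Rle_lt_trans; [apply Rabs_triang|].
    replace eps with (eps / 2 + eps / 2) by lra.
    apply Rplus_lt_compat; [apply Hp | apply Hq]; trivial; lra.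
Qed.

Lemma unif_diff_continuous {V : Type} (B : V -> Prop) p p0 e :
  0 < e -> unif_diff B p p0 ->
  exists d, 0 < d /\ forall h t, B h -> 0 < t < d -> Rabs (p t h - p0) < e.
Proof.
  intros He [D [L [HL H]]]. destruct (H 1) as [d [Hd Hp]]; [lra|].
  pose proof (Rabs_pos L).
  (* For small [t] the quotient is within 1 of [D h], hence at most [Rabs L + 1] in modulus. The
     absolute value matters because [L] may be negative when [B] is empty. *)
  exists (Rmin d (e / (Rabs L + 1))). split.
  - apply Rmin_pos; [trivial|]. apply Rdiv_lt_0_compat; lra.
  - intros h t Bh Ht.
    generalize (Rmin_l d (e / (Rabs L + 1))) (Rmin_r d (e / (Rabs L + 1))); intros.
    specialize (Hp h t Bh ltac:(lra)). specialize (HL h Bh).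
    generalize (Rle_abs L); intros.
    replace (p t h - p0) with (t * (((p t h - p0) / t - D h) + D h)) by (field; lra).
    rewrite Rabs_mult, (Rabs_pos_eq t) by lra.
    generalize (Rabs_triang ((p t h - p0) / t - D h) (D h)); intros.
    apply Rle_lt_trans with (t * (Rabs L + 1)).
    + apply Rmult_le_compat_l; lra.
    + replace e with (e / (Rabs L + 1) * (Rabs L + 1)) by (field; lra).
      apply Rmult_lt_compat_r; lra.
Qed.

(** By uniform continuity at [t = 0], each function moves by less than half the gap for small [t],
    so the maximum is eventually [q] itself. *)
Lemma unif_diff_max_lt {V : Type} (B : V -> Prop) p q p0 q0 :
  p0 < q0 -> unif_diff B p p0 -> unif_diff B q q0 ->
  unif_diff B (fun t h => Rmax (p t h) (q t h)) q0.
Proof.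
  intros Hlt Hp Hq.
  destruct (unif_diff_continuous B p p0 ((q0 - p0) / 2) ltac:(lra) Hp) as [d [Hd Hpc]].
  destruct (unif_diff_continuous B q q0 ((q0 - p0) / 2) ltac:(lra) Hq) as [d' [Hd' Hqc]].
  apply unif_diff_eventually with (q := q) (d := Rmin d d'); trivial.
  - now apply Rmin_pos.
  - intros h t Bh Ht. generalize (Rmin_l d d') (Rmin_r d d'); intros.
    specialize (Hpc h t Bh ltac:(lra)). specialize (Hqc h t Bh ltac:(lra)).
    apply Rabs_def2 in Hpc. apply Rabs_def2 in Hqc. apply Rmax_right. lra.
Qed.

Lemma Rmax_dist a b c d e :
  Rabs (a - c) < e -> Rabs (b - d) < e -> Rabs (Rmax a b - Rmax c d) < e.
Proof.
  intros H H'. apply Rabs_def2 in H. apply Rabs_def2 in H'. apply Rabs_def1;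
  unfold Rmax; destruct (Rle_dec a b), (Rle_dec c d); lra.
Qed.

Lemma unif_diff_max {V : Type} (B : V -> Prop) p q p0 q0 :
  unif_diff B p p0 -> unif_diff B q q0 ->
  unif_diff B (fun t h => Rmax (p t h) (q t h)) (Rmax p0 q0).
Proof.
  intros Hp Hq. destruct (Rtotal_order p0 q0) as [Hlt|[<-|Hgt]].
  - rewrite Rmax_right by lra. now apply unif_diff_max_lt with p0.
  (* In the case of a tie, division by [t > 0] commutes with the maximum, so the derivative is the
     maximum of the two derivatives. *)
  - destruct Hp as [D [L [HL H]]], Hq as [D' [L' [HL' H']]].
    rewrite Rmax_left by lra.
    exists (fun h => Rmax (D h) (D' h)), (Rmax L L'). split.
    + intros h Bh. specialize (HL h Bh). specialize (HL' h Bh).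
      generalize (Rmax_l L L') (Rmax_r L L'). unfold Rmax at 3. destruct (Rle_dec (D h) (D' h)); lra.
    + intros eps He. destruct (H eps He) as [d [Hd Hp]].
      destruct (H' eps He) as [d' [Hd' Hq]].
      exists (Rmin d d'). split; [now apply Rmin_pos|].
      intros h t Bh Ht. generalize (Rmin_l d d') (Rmin_r d d'); intros.
      replace ((Rmax (p t h) (q t h) - p0) / t)
        with (Rmax ((p t h - p0) / t) ((q t h - p0) / t)).
      * apply Rmax_dist; [apply Hp | apply Hq]; trivial; lra.
      * assert (Ht' : 0 < / t) by (apply Rinv_0_lt_compat; lra).
        unfold Rdiv, Rmax. destruct (Rle_dec (p t h) (q t h)), (Rle_dec _ _); trivial; nra.
  - rewrite Rmax_left by lra.
    apply unif_diff_eventually with (q := fun t h => Rmax (q t h) (p t h)) (d := 1); [lra| |].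
    + intros. apply Rmax_comm.
    + now apply unif_diff_max_lt with q0.
Qed.

(* Square roots of the polynomials [A + 2 t b + t^2 c], the shape of [|x + t h|^2] in an inner product space. *)
Lemma unif_diff_sqrt {V : Type} (B : V -> Prop) (A M : R) (b c : V -> R) :
  0 <= A -> (forall h, B h -> Rabs (b h) <= M) -> (forall h, B h -> 0 <= c h <= 1) ->
  (A = 0 -> forall h, B h -> b h = 0) ->
  (forall h t, B h -> 0 <= A + 2 * t * b h + t ^ 2 * c h) ->
  unif_diff B (fun t h => sqrt (A + 2 * t * b h + t ^ 2 * c h)) (sqrt A).
Proof.
  intros HA Hb Hc Hb0 Hpos. destruct (Req_dec A 0) as [A0|An0].
  (* If [A = 0] then [b] vanishes, the root equals t sqrt (c h), and the quotient does not depend on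
     [t]. *)
  - exists (fun h => sqrt (c h)), 1. split.
    + intros h Bh. rewrite Rabs_pos_eq by apply sqrt_pos. rewrite <- sqrt_1.
      apply sqrt_le_1_alt. now apply Hc.
    + intros eps He. exists 1. split; [lra|]. intros h t Bh Ht.
      rewrite A0, sqrt_0, (Hb0 A0 h Bh).
      replace (0 + 2 * t * 0 + t ^ 2 * c h) with (t ^ 2 * c h) by ring.
      rewrite sqrt_mult_alt by nra. rewrite sqrt_pow2 by lra.
      replace ((t * sqrt (c h) - 0) / t - sqrt (c h)) with 0 by (field; lra).
      now rewrite Rabs_R0.
  - assert (HA' : 0 < A) by lra. pose proof (sqrt_lt_R0 A HA') as Hs.
    assert (Hss : sqrt A * sqrt A = A) by (apply sqrt_sqrt; lra).
    set (s := sqrt A) in *.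
    set (P := Rabs M + 1). assert (HP : 1 <= P) by (unfold P; generalize (Rabs_pos M); lra).
    exists (fun h => b h / s), (P / s). split.
    + intros h Bh. unfold Rdiv. rewrite Rabs_mult, (Rabs_pos_eq (/ s)).
      * apply Rmult_le_compat_r; [left; now apply Rinv_0_lt_compat|].
        generalize (Hb h Bh) (Rle_abs M). unfold P. lra.
      * left; now apply Rinv_0_lt_compat.
    + intros eps He.
      (* [k] adds the bounds, divided by [t], of the two error terms into which the quotient is
         split below: t c / (r + s) is at most t / s, and b (s - r) / ((r + s) s) is at most P (3 P
         t / s) / s^2. *)
      set (k := 1 / s + P * (3 * P) / (s * s * s)).
      assert (Hk : 0 < k).
      { unfold k. apply Rplus_lt_le_0_compat; [apply Rdiv_lt_0_compat; lra|].
        left; apply Rdiv_lt_0_compat; [nra|]. repeat apply Rmult_lt_0_compat; trivial. }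
      exists (Rmin 1 (eps / k)). split.
      { apply Rmin_pos; [lra|]. now apply Rdiv_lt_0_compat. }
      intros h t Bh Ht.
      generalize (Rmin_l 1 (eps / k)) (Rmin_r 1 (eps / k)); intros.
      specialize (Hpos h t Bh). specialize (Hb h Bh). specialize (Hc h Bh).
      pose proof (sqrt_pos (A + 2 * t * b h + t ^ 2 * c h)) as Hr.
      pose proof (sqrt_sqrt _ Hpos) as Hrr.
      set (r := sqrt (A + 2 * t * b h + t ^ 2 * c h)) in *.
      assert (HbP : Rabs (b h) <= P) by (generalize (Rle_abs M); unfold P; lra).
      assert (Hbb : - P <= b h <= P) by (now apply Rabs_le_between).
      (* Here r - s = (r^2 - s^2) / (r + s), and 2 b + t c is at most 3 P in modulus because t < 1
         <= P. *)
      assert (Hrs : Rabs (r - s) <= t * (3 * P) / s).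
      { replace (r - s) with (t * (2 * b h + t * c h) / (r + s)).
        - unfold Rdiv. rewrite !Rabs_mult, (Rabs_pos_eq t) by lra.
          rewrite (Rabs_pos_eq (/ _)) by (left; apply Rinv_0_lt_compat; lra).
          apply Rmult_le_compat.
          + apply Rmult_le_pos; [lra|apply Rabs_pos].
          + left; apply Rinv_0_lt_compat; lra.
          + apply Rmult_le_compat_l; [lra|]. apply Rabs_le. assert (0 <= t * c h <= 1) by nra. lra.
          + apply Rinv_le_contravar; lra.
        - replace (t * (2 * b h + t * c h)) with (r * r - s * s) by (rewrite Hrr, Hss; ring).
          field. lra. }
      replace ((r - s) / t - b h / s) with (t * c h / (r + s) + b h * (s - r) / ((r + s) * s)).
      * apply Rle_lt_trans with (t * k).
        -- eapply Rle_trans; [apply Rabs_triang|]. unfold k. rewrite Rmult_plus_distr_l.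
           apply Rplus_le_compat.
           ++ rewrite Rabs_pos_eq.
              ** unfold Rdiv. rewrite Rmult_1_l. apply Rmult_le_compat; try nra.
                 left; apply Rinv_0_lt_compat; lra. apply Rinv_le_contravar; lra.
              ** apply Rmult_le_pos; [nra|]. left; apply Rinv_0_lt_compat; lra.
           ++ unfold Rdiv. rewrite !Rabs_mult, (Rabs_minus_sym s r).
              rewrite (Rabs_pos_eq (/ _)) by (left; apply Rinv_0_lt_compat; nra).
              apply Rle_trans with (P * (t * (3 * P) / s) * / (s * s)).
              ** apply Rmult_le_compat.
                 --- apply Rmult_le_pos; apply Rabs_pos.
                 --- left; apply Rinv_0_lt_compat; nra.
                 --- apply Rmult_le_compat; trivial; apply Rabs_pos.
                 --- apply Rinv_le_contravar; nra.
              ** right. field. lra.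
        -- replace eps with (eps / k * k) by (field; lra). apply Rmult_lt_compat_r; lra.
      * assert (E : r - s = t * (2 * b h + t * c h) / (r + s)).
        { replace (t * (2 * b h + t * c h)) with (r * r - s * s) by (rewrite Hrr, Hss; ring).
          field. lra. }
        replace (s - r) with (- (r - s)) by ring.
        assert (E2 : c h * t = (r - s) * (r + s) / t - 2 * b h).
        { rewrite E. field. lra. }
        replace (t * c h) with ((r - s) * (r + s) / t - 2 * b h) by lra.
        field. lra.
Qed.

(** * Norms of c_0 and Z *)

Lemma is_series_half_powers : is_series (fun n => / 2 ^ S n) 1.
Proof.
  apply is_series_ext with (fun n => / 2 * (/ 2) ^ n).
  - intro n. simpl. rewrite pow_inv, Rinv_mult. reflexivity.
  - replace 1 with (/ 2 * / (1 - / 2)) by field.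
    apply (is_series_scal_l (K := R_AbsRing) (V := R_NormedModule) (/ 2)). apply is_series_geom. rewrite Rabs_pos_eq; lra.
Qed.

Lemma Rabs_div_pow2_le a M n : Rabs a <= M -> Rabs (a / 2 ^ S n) <= M * / 2 ^ S n.
Proof.
  intros H. assert (0 < / 2 ^ S n) by (apply Rinv_0_lt_compat, pow_lt; lra).
  unfold Rdiv. rewrite Rabs_mult, (Rabs_pos_eq (/ _)) by lra.
  apply Rmult_le_compat_r; lra.
Qed.

Lemma ex_series_weighted (a : nat -> R) M :
  (forall n, Rabs (a n) <= M) -> ex_series (fun n => Rabs (a n / 2 ^ S n)).
Proof.
  intros H. apply (ex_series_le (K := R_AbsRing) (V := R_CompleteNormedModule) _ (fun n => M * / 2 ^ S n)).
  - intro n. change (Rabs (Rabs (a n / 2 ^ S n)) <= M * / 2 ^ S n). rewrite Rabs_Rabsolu. now apply Rabs_div_pow2_le.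
  - apply (ex_series_scal_l (K := R_AbsRing) (V := R_NormedModule) M). exists 1. apply is_series_half_powers.
Qed.

Lemma Series_weighted_le (a : nat -> R) M :
  (forall n, Rabs (a n) <= M) -> Rabs (Series (fun n => a n / 2 ^ S n)) <= M.
Proof.
  intros H. pose proof (ex_series_weighted a M H) as E.
  eapply Rle_trans; [now apply Series_Rabs|].
  replace M with (Series (fun n => M * / 2 ^ S n)).
  - apply Series_le.
    + intro n. split; [apply Rabs_pos|]. now apply Rabs_div_pow2_le.
    + apply (ex_series_scal_l (K := R_AbsRing) (V := R_NormedModule) M). exists 1. apply is_series_half_powers.
  - rewrite Series_scal_l, (is_series_unique _ _ is_series_half_powers). ring.
Qed.

Lemma Series_ge0 (a : nat -> R) : (forall n, 0 <= a n) -> ex_series a -> 0 <= Series a.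
Proof.
  intros H E. replace 0 with (Series (fun n => 0 * a n)) by (rewrite Series_scal_l; ring).
  apply Series_le; trivial. intro n. specialize (H n). lra.
Qed.

Lemma Series_ge_term (a : nat -> R) n :
  (forall n, 0 <= a n) -> ex_series a -> a n <= Series a.
Proof.
  intros H. revert a H. induction n as [|n IH]; intros a H E; rewrite Series_incr_1 by trivial;
    apply (ex_series_incr_1 (K := R_AbsRing) (V := R_NormedModule)) in E.
  - generalize (Series_ge0 _ (fun k => H (S k)) E). lra.
  - generalize (IH _ (fun k => H (S k)) E) (H 0%nat). lra.
Qed.

Lemma Series_ge_two_terms (a : nat -> R) n :
  (forall n, 0 <= a n) -> ex_series a -> a 0%nat + a (S n) <= Series a.
Proof.
  intros H E. rewrite Series_incr_1 by trivial.
  apply (ex_series_incr_1 (K := R_AbsRing) (V := R_NormedModule)) in E.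
  generalize (Series_ge_term _ n (fun k => H (S k)) E). lra.
Qed.

Lemma ex_series_sq_weighted (a : nat -> R) M :
  (forall n, 0 <= a n <= M) -> ex_series (fun n => a n ^ 2 / 2 ^ S n).
Proof.
  intros H. apply ex_series_Rabs. apply (ex_series_weighted (fun n => a n ^ 2) (M ^ 2)).
  intro n. rewrite Rabs_pos_eq by apply pow2_ge_0. apply pow_incr, H.
Qed.

Lemma sq_weighted_ge0 (a : nat -> R) n : 0 <= a n ^ 2 / 2 ^ S n.
Proof. apply Rdiv_le_0_compat; [apply pow2_ge_0 | apply pow_lt; lra]. Qed.

Section Norms.
Variables (K : AbsRing) (ofR : R -> K) (ip : K -> K -> R).
Hypothesis HK : real_or_complex K ofR ip.

Lemma abs_ofR_mult t (x : K) : 0 <= t -> abs (mult (ofR t) x) = t * abs x.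
Proof.
  intro Ht. rewrite (rc_abs_mult _ _ _ HK), (rc_abs_ofR _ _ _ HK), Rabs_pos_eq; trivial.
Qed.

(** Cauchy-Schwarz follows from the triangle inequality: expand the squared modulus of x + t y for t
    = 1 and t = -1 and compare with the square of abs x + abs y. *)
Lemma ip_le (x y : K) : Rabs (ip x y) <= abs x * abs y.
Proof.
  assert (H : forall t, Rabs t = 1 ->
    abs (plus x (mult (ofR t) y)) ^ 2 <= (abs x + abs y) ^ 2).
  { intros t Ht. apply pow_incr. split; [apply abs_ge_0|].
    eapply Rle_trans; [apply abs_triangle|].
    rewrite (rc_abs_mult _ _ _ HK), (rc_abs_ofR _ _ _ HK), Ht. lra. }
  generalize (H 1 Rabs_R1) (H (-1) ltac:(rewrite Rabs_left; lra)).
  rewrite !(rc_sq _ _ _ HK). intros. apply Rabs_le. split; lra.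
Qed.

Fixpoint finmax (N : nat) (u : nat -> K) : R :=
  match N with O => 0 | S N' => Rmax (finmax N' u) (abs (u N')) end.

Lemma finmax_ge N u n : (n < N)%nat -> abs (u n) <= finmax N u.
Proof.
  induction N as [|N IH]; intros H; [lia|]. simpl.
  destruct (Nat.eq_dec n N) as [->|]; [apply Rmax_r|].
  eapply Rle_trans; [apply IH; lia | apply Rmax_l].
Qed.

Lemma finmax_le N u M : 0 <= M -> (forall n, abs (u n) <= M) -> finmax N u <= M.
Proof. intros H0 H. induction N; simpl; [trivial | now apply Rmax_lub]. Qed.

Lemma finmax_lipschitz N u v d :
  0 <= d -> (forall n, abs (u n) <= abs (v n) + d) -> finmax N u <= finmax N v + d.
Proof.
  intros Hd H. induction N as [|N IH]; simpl; [lra|].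
  generalize (Rmax_l (finmax N v) (abs (v N))) (Rmax_r (finmax N v) (abs (v N))) (H N).
  intros. apply Rmax_lub; lra.
Qed.

Lemma c0_bounded u : is_c0 K u -> exists M, forall n, abs (u n) <= M.
Proof.
  intros H. destruct (H 1) as [N HN]; [lra|]. exists (Rmax (finmax N u) 1). intro n.
  destruct (Nat.lt_ge_cases n N) as [h|h].
  - eapply Rle_trans; [now apply (finmax_ge N) | apply Rmax_l].
  - left. eapply Rlt_le_trans; [now apply HN | apply Rmax_r].
Qed.

(** [supnorm] converts an extended supremum by [real]. The bound [M] excludes plus infinity and the
    entry at index 0 excludes minus infinity, so no default value intervenes. *)
Lemma supnorm_is_lub u M :
  (forall n, abs (u n) <= M) -> is_lub (fun r => exists n, r = abs (u n)) (supnorm K u).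
Proof.
  intros H. unfold supnorm.
  destruct (Lub_Rbar_correct (fun r => exists n, r = abs (u n))) as [Hub Hl].
  assert (HM : Rbar_le (Lub_Rbar (fun r => exists n, r = abs (u n))) M).
  { apply Hl. intros r [n ->]. apply H. }
  pose proof (Hub (abs (u 0%nat)) (ex_intro _ 0%nat eq_refl)) as H0.
  destruct (Lub_Rbar _) as [l| |]; simpl in *; try easy.
  split.
  - intros r Hr. now apply Hub.
  - intros b Hb. apply (Hl b). intros r Hr. now apply Hb.
Qed.

Lemma supnorm_le u M : (forall n, abs (u n) <= M) -> supnorm K u <= M.
Proof. intros H. apply (supnorm_is_lub u M H). intros r [n ->]. apply H. Qed.

Lemma abs_le_supnorm u n : is_c0 K u -> abs (u n) <= supnorm K u.
Proof.
  intros H. destruct (c0_bounded u H) as [M HM].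
  apply (supnorm_is_lub u M HM). now exists n.
Qed.

Lemma supnorm_ge0 u : is_c0 K u -> 0 <= supnorm K u.
Proof. intros H. eapply Rle_trans; [apply (abs_ge_0 (u 0%nat)) | now apply abs_le_supnorm]. Qed.

Lemma supnorm_eq_finmax u N :
  is_c0 K u -> (forall n, (N <= n)%nat -> abs (u n) <= finmax N u) -> supnorm K u = finmax N u.
Proof.
  intros Hu H. apply Rle_antisym.
  - apply supnorm_le. intro n. destruct (Nat.lt_ge_cases n N); [now apply (finmax_ge N) | now apply H].
  - apply finmax_le; [now apply supnorm_ge0 | intro; now apply abs_le_supnorm].
Qed.

Lemma c0_affine u v t : is_c0 K u -> is_c0 K v -> is_c0 K (fun n => plus (u n) (mult t (v n))).
Proof.
  intros Hu Hv eps He. pose proof (abs_ge_0 t) as Ht.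
  destruct (Hu (eps / 2)) as [N HN]; [lra|].
  destruct (Hv (eps / 2 / (abs t + 1))) as [N' HN']; [apply Rdiv_lt_0_compat; lra|].
  exists (N + N')%nat. intros n Hn.
  eapply Rle_lt_trans; [apply abs_triangle|]. rewrite (rc_abs_mult _ _ _ HK).
  specialize (HN n ltac:(lia)). specialize (HN' n ltac:(lia)).
  assert (abs t * abs (v n) <= (abs t + 1) * (eps / 2 / (abs t + 1))).
  { apply Rmult_le_compat; try lra. apply abs_ge_0. }
  replace ((abs t + 1) * (eps / 2 / (abs t + 1))) with (eps / 2) in H by (field; lra). lra.
Qed.

Lemma Znorm_ge_supnorm z : supnorm K z <= Znorm K z.
Proof. unfold Znorm. generalize (sqrt_pos (Series (fun n => abs (z n) ^ 2 / 2 ^ S n))). lra. Qed.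

Lemma Znorm_le z B : (forall n, abs (z n) <= B) -> Znorm K z <= 2 * B.
Proof.
  intros H. assert (0 <= B) by (eapply Rle_trans; [apply (abs_ge_0 (z 0%nat)) | apply (H 0%nat)]).
  unfold Znorm. replace (2 * B) with (B + B) by ring. apply Rplus_le_compat; [now apply supnorm_le|].
  rewrite <- (sqrt_pow2 B) by trivial. apply sqrt_le_1_alt.
  eapply Rle_trans; [apply Rle_abs|]. apply (Series_weighted_le (fun n => abs (z n) ^ 2)).
  intro n. rewrite Rabs_pos_eq by apply pow2_ge_0. apply pow_incr. split; [apply abs_ge_0 | apply H].
Qed.

Lemma abs_fst_le_nX x n : inX K x -> abs (fst x n) <= nX K x.
Proof.
  intros [H _]. eapply Rle_trans; [now apply abs_le_supnorm | apply Rmax_l].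
Qed.

Lemma Znorm_le_nX x : Znorm K (snd x) <= nX K x.
Proof. apply Rmax_r. Qed.

Lemma abs_snd_le_nX x n : inX K x -> abs (snd x n) <= nX K x.
Proof.
  intros [_ H]. eapply Rle_trans; [now apply abs_le_supnorm|].
  eapply Rle_trans; [apply Znorm_ge_supnorm | apply Znorm_le_nX].
Qed.

(** * Differentiability of the sup norm and of the weighted norm along lines *)

Section Differentiability.
Variables (V : Type) (B : V -> Prop) (g : V -> nat -> K) (u : nat -> K).
Hypothesis Hg : forall h, B h -> is_c0 K (g h) /\ forall n, abs (g h n) <= 1.
Hypothesis Hu : is_c0 K u.

Let line t h n := plus (u n) (mult (ofR t) (g h n)).

(** By [rc_sq] the modulus is the square root of a quadratic polynomial in [t], so [unif_diff_sqrt]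
    applies. *)
Lemma unif_diff_coordinate n : unif_diff B (fun t h => abs (line t h n)) (abs (u n)).
Proof.
  pose proof (abs_ge_0 (u n)) as Hun.
  assert (E : forall t h, abs (u n) ^ 2 + 2 * t * ip (u n) (g h n) + t ^ 2 * abs (g h n) ^ 2
    = abs (line t h n) ^ 2) by (intros; unfold line; now rewrite (rc_sq _ _ _ HK)).
  rewrite <- (sqrt_pow2 (abs (u n))) by trivial.
  apply unif_diff_eventually with (d := 1) (q := fun t h =>
    sqrt (abs (u n) ^ 2 + 2 * t * ip (u n) (g h n) + t ^ 2 * abs (g h n) ^ 2)); [lra| |].
  - intros h t _ _. rewrite E. symmetry. apply sqrt_pow2, abs_ge_0.
  - apply unif_diff_sqrt with (M := abs (u n)).
    + apply pow2_ge_0.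
    + intros h Bh. eapply Rle_trans; [apply ip_le|].
      destruct (Hg h Bh) as [_ H]. specialize (H n). nra.
    + intros h Bh. split; [apply pow2_ge_0|].
      destruct (Hg h Bh) as [_ H]. specialize (H n). pose proof (abs_ge_0 (g h n)). nra.
    + intros H h _. generalize (ip_le (u n) (g h n)).
      replace (abs (u n)) with 0 by nra. rewrite Rmult_0_l. intros.
      apply Rabs_eq_0. generalize (Rabs_pos (ip (u n) (g h n))). lra.
    + intros h t _. rewrite E. apply pow2_ge_0.
Qed.

Lemma unif_diff_finmax N : unif_diff B (fun t h => finmax N (line t h)) (finmax N u).
Proof.
  induction N as [|N IH]; simpl.
  - apply unif_diff_const.
  - apply unif_diff_max; [exact IH | apply unif_diff_coordinate].
Qed.

Lemma supnorm_scal t h : 0 < t -> is_c0 K h -> supnorm K (fun n => mult (ofR t) (h n)) = t * supnorm K h.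
Proof.
  intros Ht Hh. apply Rle_antisym.
  - apply supnorm_le. intro n. rewrite abs_ofR_mult by lra.
    apply Rmult_le_compat_l; [lra | now apply abs_le_supnorm].
  - assert (H : supnorm K h <= supnorm K (fun n => mult (ofR t) (h n)) / t).
    { apply supnorm_le. intro n. apply Rle_div_r; trivial.
      rewrite Rmult_comm, <- abs_ofR_mult by lra.
      apply (supnorm_is_lub _ (t * supnorm K h)); [|now exists n].
      intro m. rewrite abs_ofR_mult by lra.
      apply Rmult_le_compat_l; [lra | now apply abs_le_supnorm]. }
    apply (Rle_div_r _ _ _ Ht) in H. lra.
Qed.

(* Away from [0] the supremum norm of [c_0] is locally a maximum of finitely many moduli. *)
Lemma unif_diff_supnorm : unif_diff B (fun t h => supnorm K (line t h)) (supnorm K u).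
Proof.
  pose proof (supnorm_ge0 u Hu) as Hs0. set (s := supnorm K u) in *.
  destruct (Req_dec s 0) as [Hs|Hs].
  (* At the origin the norm along the line is exactly [t] times the norm of the direction. *)
  - assert (Hun : forall n, u n = zero).
    { intro n. apply abs_eq_zero. generalize (abs_le_supnorm u n Hu) (abs_ge_0 (u n)).
      fold s. lra. }
    exists (fun h => supnorm K (g h)), 1. split.
    + intros h Bh. destruct (Hg h Bh) as [Hc H1].
      rewrite Rabs_pos_eq by now apply supnorm_ge0. now apply supnorm_le.
    + intros eps He. exists 1. split; [lra|]. intros h t Bh Ht.
      replace (line t h) with (fun n => mult (ofR t) (g h n)).
      * rewrite supnorm_scal by (try lra; now apply Hg). rewrite Hs.
        replace ((t * supnorm K (g h) - 0) / t - supnorm K (g h)) with 0 by (field; lra).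
        now rewrite Rabs_R0.
      * apply functional_extensionality. intro n. unfold line. now rewrite Hun, plus_zero_l.
  - assert (Hs1 : 0 < s) by lra. destruct (Hu (s / 2)) as [N HN]; [lra|].
    assert (HsN : s <= finmax N u).
    { assert (s <= Rmax (finmax N u) (s / 2)).
      { apply supnorm_le. intro n. destruct (Nat.lt_ge_cases n N) as [h|h].
        - eapply Rle_trans; [now apply (finmax_ge N) | apply Rmax_l].
        - left. eapply Rlt_le_trans; [now apply HN | apply Rmax_r]. }
      revert H. unfold Rmax. destruct (Rle_dec _ _); lra. }
    assert (E : s = finmax N u).
    { apply supnorm_eq_finmax; trivial. intros n Hn. specialize (HN n Hn). lra. }
    (* Beyond [N] the entries stay below s / 2 + t, while the finite maximum stays above s - t. The
       radius s / 4 keeps the first bound below the second. *)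
    rewrite E. apply unif_diff_eventually with (q := fun t h => finmax N (line t h)) (d := s / 4);
      [lra | | apply unif_diff_finmax].
    intros h t Bh Ht. destruct (Hg h Bh) as [Hc H1].
    assert (Hth : forall n, abs (mult (ofR t) (g h n)) <= t).
    { intro n. rewrite abs_ofR_mult by lra. specialize (H1 n). nra. }
    apply supnorm_eq_finmax; [now apply c0_affine|].
    intros n Hn. apply Rle_trans with (s / 2 + t).
    + unfold line. eapply Rle_trans; [apply abs_triangle|]. specialize (HN n Hn).
      specialize (Hth n). lra.
    + assert (finmax N u <= finmax N (line t h) + t); [|lra].
      apply finmax_lipschitz; [lra|]. intro m.
      replace (u m) with (plus (line t h m) (opp (mult (ofR t) (g h m)))).
      * assert (abs (opp (mult (ofR t) (g h m))) <= t)
          by (eapply Rle_trans; [right; apply abs_opp | apply Hth]).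
        eapply Rle_trans; [apply abs_triangle|]. lra.
      * unfold line. rewrite <- plus_assoc. etransitivity; [|apply plus_zero_r].
        apply f_equal. exact (@plus_opp_r K _).
Qed.

(** Summing [rc_sq] over the coordinates turns the series into a quadratic polynomial in [t] whose
    coefficients are bounded uniformly in [h], again the situation of [unif_diff_sqrt]. *)
Lemma unif_diff_weighted :
  unif_diff B (fun t h => sqrt (Series (fun n => abs (line t h n) ^ 2 / 2 ^ S n)))
    (sqrt (Series (fun n => abs (u n) ^ 2 / 2 ^ S n))).
Proof.
  destruct (c0_bounded u Hu) as [M HM].
  assert (HM0 : 0 <= M) by (eapply Rle_trans; [apply (abs_ge_0 (u 0%nat)) | apply (HM 0%nat)]).
  assert (Hip : forall h, B h -> forall n, Rabs (ip (u n) (g h n)) <= M).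
  { intros h Bh n. eapply Rle_trans; [apply ip_le|]. destruct (Hg h Bh) as [_ H].
    specialize (H n). specialize (HM n). generalize (abs_ge_0 (u n)) (abs_ge_0 (g h n)). nra. }
  assert (Hu2 : ex_series (fun n => abs (u n) ^ 2 / 2 ^ S n)).
  { apply ex_series_sq_weighted with M. intro n. split; [apply abs_ge_0 | apply HM]. }
  assert (Hg2 : forall h, B h -> ex_series (fun n => abs (g h n) ^ 2 / 2 ^ S n)).
  { intros h Bh. apply ex_series_sq_weighted with 1. intro n.
    split; [apply abs_ge_0 | now apply Hg]. }
  assert (Hug : forall h, B h -> ex_series (fun n => ip (u n) (g h n) / 2 ^ S n)).
  { intros h Bh. apply ex_series_Rabs, ex_series_weighted with M. now apply Hip. }
  assert (E : forall h t, B h -> Series (fun n => abs (line t h n) ^ 2 / 2 ^ S n) =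
    Series (fun n => abs (u n) ^ 2 / 2 ^ S n) + 2 * t * Series (fun n => ip (u n) (g h n) / 2 ^ S n)
    + t ^ 2 * Series (fun n => abs (g h n) ^ 2 / 2 ^ S n)).
  { intros h t Bh. rewrite <- !Series_scal_l.
    assert (H1 : ex_series (fun n => 2 * t * (ip (u n) (g h n) / 2 ^ S n)))
      by (apply (ex_series_scal_l (K := R_AbsRing) (V := R_NormedModule) (2 * t)); auto).
    assert (H2 : ex_series (fun n => t ^ 2 * (abs (g h n) ^ 2 / 2 ^ S n)))
      by (apply (ex_series_scal_l (K := R_AbsRing) (V := R_NormedModule) (t ^ 2)); auto).
    rewrite <- (Series_plus _ _ Hu2 H1).
    rewrite <- Series_plus;
      [|exact (ex_series_plus (K := R_AbsRing) (V := R_NormedModule) _ _ Hu2 H1)|exact H2].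
    apply Series_ext. intro n. unfold line. rewrite (rc_sq _ _ _ HK).
    field. apply pow_nonzero. lra. }
  apply unif_diff_eventually with (d := 1) (q := fun t h =>
    sqrt (Series (fun n => abs (u n) ^ 2 / 2 ^ S n) + 2 * t * Series (fun n => ip (u n) (g h n) / 2 ^ S n)
    + t ^ 2 * Series (fun n => abs (g h n) ^ 2 / 2 ^ S n))); [lra| |].
  - intros h t Bh _. now rewrite E.
  - apply unif_diff_sqrt with (M := M).
    + apply Series_ge0; trivial. intro. apply (sq_weighted_ge0 (fun n => abs (u n))).
    + intros h Bh. apply Series_weighted_le. auto.
    + intros h Bh. split.
      * apply Series_ge0; auto. intro. apply (sq_weighted_ge0 (fun n => abs (g h n))).
      * eapply Rle_trans; [apply Rle_abs|]. apply (Series_weighted_le (fun n => abs (g h n) ^ 2)).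
        intro n. rewrite Rabs_pos_eq by apply pow2_ge_0. destruct (Hg h Bh) as [_ H].
        specialize (H n). pose proof (abs_ge_0 (g h n)). nra.
    (* A vanishing series of nonnegative terms has only zero terms, so [u] is zero and the linear
       coefficient vanishes. *)
    + intros H0 h Bh.
      replace 0 with (Series (fun n => 0 * (ip (u n) (g h n) / 2 ^ S n)))
        by (rewrite Series_scal_l; ring).
      apply Series_ext. intro n.
      assert (Hn : abs (u n) ^ 2 = 0).
      { pose proof (Series_ge_term _ n (sq_weighted_ge0 (fun n => abs (u n))) Hu2) as H.
        cbv beta in H. rewrite H0 in H. apply Rle_div_l in H; [|apply Rlt_gt, pow_lt; lra].
        generalize (pow2_ge_0 (abs (u n))). lra. }
      generalize (ip_le (u n) (g h n)). replace (abs (u n)) with 0 by nra.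
      rewrite Rmult_0_l. intros. replace (ip (u n) (g h n)) with 0; [field; apply pow_nonzero; lra|].
      symmetry. apply Rabs_eq_0. generalize (Rabs_pos (ip (u n) (g h n))). lra.
    + intros h t Bh. rewrite <- E by trivial. destruct (Hg h Bh) as [Hc _].
      destruct (c0_bounded (line t h) (c0_affine u (g h) (ofR t) Hu Hc)) as [M' HM'].
      apply Series_ge0; [intro; apply (sq_weighted_ge0 (fun n => abs (line t h n)))|].
      apply ex_series_sq_weighted with M'. intro n. split; [apply abs_ge_0 | apply HM'].
Qed.

End Differentiability.

(** The norm is a maximum of a sup norm with the sum of a sup norm and a weighted norm, and all
    coordinates of a direction in the unit ball have modulus at most 1, so the stability rules
    combine. *)
Lemma norm_SSD_X : norm_SSD K ofR.
Proof.
  intros x [Hx1 Hx2].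
  set (B := fun h => inX K h /\ nX K h <= 1).
  assert (H1 : forall h, B h -> is_c0 K (fst h) /\ forall n, abs (fst h n) <= 1).
  { intros h [Hh Hn]. split; [apply Hh|]. intro n.
    eapply Rle_trans; [now apply abs_fst_le_nX | trivial]. }
  assert (H2 : forall h, B h -> is_c0 K (snd h) /\ forall n, abs (snd h n) <= 1).
  { intros h [Hh Hn]. split; [apply Hh|]. intro n.
    eapply Rle_trans; [now apply abs_snd_le_nX | trivial]. }
  destruct (unif_diff_max B _ _ _ _ (unif_diff_supnorm _ B (@fst _ _) (fst x) H1 Hx1)
    (unif_diff_plus B _ _ _ _ (unif_diff_supnorm _ B (@snd _ _) (snd x) H2 Hx2)
      (unif_diff_weighted _ B (@snd _ _) (snd x) H2 Hx2))) as [D [L [_ HD]]].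
  exists D. intros eps He. destruct (HD eps He) as [d [Hd Hq]]. exists d. split; [trivial|].
  intros h t Hh Hn Ht. apply (Hq h t); [now split | trivial].
Qed.

End Norms.

(** * Failure of the numerical radius property *)

(** The partial sums telescope. In the applications [b j] is an explicit bound for the tail from
    index [j] on, which gives sharp bounds for weighted series. *)
Lemma Series_le_telescope (a b : nat -> R) :
  (forall k, 0 <= b k) -> (forall k, a k <= b k - b (S k)) -> ex_series a -> Series a <= b 0%nat.
Proof.
  intros Hb Ha E.
  assert (H : forall n, sum_n a n <= b 0%nat - b (S n)).
  { induction n as [|n IH].
    - rewrite sum_O. apply Ha.
    - rewrite sum_Sn. generalize (Ha (S n)). unfold plus; simpl. lra. }
  apply (is_lim_seq_le (sum_n a) (fun _ => b 0%nat) (Series a) (b 0%nat)).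
  - intro n. generalize (H n) (Hb (S n)). lra.
  - exact (Series_correct a E).
  - apply is_lim_seq_const.
Qed.

Lemma half_power_bounds n : 0 < / 2 ^ S n <= 1 / 2.
Proof.
  assert (H : 1 <= 2 ^ n) by (apply pow_R1_Rle; lra).
  simpl. split.
  - apply Rinv_0_lt_compat. lra.
  - replace (1 / 2) with (/ 2) by lra. apply Rinv_le_contravar; lra.
Qed.

(** Cauchy-Schwarz for the pairs (p, s) and (U, W) with weights 1/2 and k. After squaring, the two
    sides differ by (k / 2) (p W - s U)^2. *)
Lemma cauchy_schwarz_weighted p q s k U W :
  0 < q -> q ^ 2 = p ^ 2 / 2 + s ^ 2 * k -> 0 <= k ->
  (p * U / 2 + s * k * W) / q <= sqrt (U ^ 2 / 2 + k * W ^ 2).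
Proof.
  intros Hq Hqq Hk. apply Rle_div_l; [lra|].
  rewrite <- (sqrt_pow2 q) by lra. rewrite <- sqrt_mult by nra.
  apply Rsqr_incr_0_var; [|apply sqrt_pos]. rewrite Rsqr_sqrt by (rewrite Hqq; apply Rmult_le_pos; nra).
  rewrite Hqq. unfold Rsqr. assert (0 <= k * (p * W - s * U) ^ 2) by (apply Rmult_le_pos; [trivial|apply pow2_ge_0]).
  nra.
Qed.

(** The weighted part of the norm of Z at e_0 + s e_{n+1}, when [k] is the weight 2^-(n+2) of
    coordinate n + 1. *)
Definition wnorm (k s : R) : R := sqrt (1 / 2 + s ^ 2 * k).

(** * Second order dependence on [s] of the supporting functionals *)

Section WNorm.
Variables (k s : R).
Hypothesis Hk : 0 < k <= 1 / 2.
Hypothesis Hs : -1 <= s <= 1.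

Lemma sq_weight_bounds : 0 <= s ^ 2 * k <= s ^ 2 /\ s ^ 2 * k <= 1 / 2.
Proof.
  assert (0 <= s ^ 2 <= 1) by (simpl; nra). nra.
Qed.

Lemma wnorm_sq : wnorm k s ^ 2 = 1 / 2 + s ^ 2 * k.
Proof. generalize sq_weight_bounds. intros. unfold wnorm. rewrite pow2_sqrt; lra. Qed.

Lemma wnorm_bounds : 7 / 10 <= wnorm k s <= 1.
Proof.
  generalize sq_weight_bounds. intros. split; unfold wnorm.
  - rewrite <- (sqrt_pow2 (7 / 10)) by lra. apply sqrt_le_1_alt. lra.
  - apply Rle_trans with (sqrt 1); [apply sqrt_le_1_alt; lra | rewrite sqrt_1; lra].
Qed.

(** [wnorm] depends on [s] only through s^2, and its square changes by s^2 k. Hence the coefficient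
    at e_0 of the supporting functional has no first order term. *)
Lemma wnorm_deviation : Rabs (/ (2 * wnorm k s) - / (2 * wnorm k 0)) <= s ^ 2.
Proof.
  pose proof wnorm_sq as H. pose proof wnorm_bounds as Hb.
  assert (H0 : wnorm k 0 ^ 2 = 1 / 2) by (unfold wnorm; rewrite pow2_sqrt; lra).
  assert (Hb0 : 7 / 10 <= wnorm k 0).
  { unfold wnorm. rewrite <- (sqrt_pow2 (7 / 10)) by lra. apply sqrt_le_1_alt. lra. }
  set (q := wnorm k s) in *. set (q0 := wnorm k 0) in *.
  replace (/ (2 * q) - / (2 * q0)) with (- (s ^ 2 * k) / ((q + q0) * (2 * q * q0))).
  - unfold Rdiv. rewrite Rabs_mult, Rabs_Ropp, !Rabs_pos_eq.
    + assert (1 <= (q + q0) * (2 * q * q0)) by nra.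
      assert (/ ((q + q0) * (2 * q * q0)) <= 1) by (rewrite <- Rinv_1; apply Rinv_le_contravar; lra).
      destruct sq_weight_bounds. nra.
    + left; apply Rinv_0_lt_compat. nra.
    + apply sq_weight_bounds.
  - replace (s ^ 2 * k) with (q ^ 2 - q0 ^ 2) by lra. field. lra.
Qed.

(** With q^2 = 1/2 + s^2 k, the difference is exactly - s^2 k / (q (1 + q)). The ratio is the
    coefficient of the functional at e_0 times the coordinate of the test point there. *)
Lemma support_ratio_deviation : Rabs ((1 + / (2 * wnorm k s)) / (1 + wnorm k s) - 1) <= s ^ 2.
Proof.
  pose proof wnorm_sq as H. pose proof wnorm_bounds as Hb.
  set (q := wnorm k s) in *.
  replace ((1 + / (2 * q)) / (1 + q) - 1) with (- (s ^ 2 * k) * / (q * (1 + q))).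
  - rewrite Rabs_mult, Rabs_Ropp, !Rabs_pos_eq.
    + assert (1 <= q * (1 + q)) by nra.
      assert (/ (q * (1 + q)) <= 1) by (rewrite <- Rinv_1; apply Rinv_le_contravar; lra).
      destruct sq_weight_bounds. nra.
    + left; apply Rinv_0_lt_compat. nra.
    + apply sq_weight_bounds.
  - replace (s ^ 2 * k) with (q ^ 2 - 1 / 2) by lra. field. lra.
Qed.

Lemma cross_term_bound : Rabs (s * k / wnorm k s * (s / (1 + wnorm k s))) <= s ^ 2.
Proof.
  pose proof wnorm_bounds as Hb. set (q := wnorm k s) in *.
  replace (s * k / q * (s / (1 + q))) with (s ^ 2 * k * / (q * (1 + q))) by (field; lra).
  rewrite Rabs_mult, !Rabs_pos_eq.
  - assert (1 <= q * (1 + q)) by nra.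
    assert (/ (q * (1 + q)) <= 1) by (rewrite <- Rinv_1; apply Rinv_le_contravar; lra).
    destruct sq_weight_bounds. nra.
  - left; apply Rinv_0_lt_compat. nra.
  - apply sq_weight_bounds.
Qed.

End WNorm.

Section Counterexample.
Variables (K : AbsRing) (ofR : R -> K) (ip : K -> K -> R).
Hypothesis HK : real_or_complex K ofR ip.

(* The operations of [K] occur in terms through several convertible structure projections, whereas [ring] matches
   them syntactically: [kring] first folds them into these constants. *)
Definition kzero : K := zero.
Definition kone : K := one.
Definition kplus (x y : K) : K := plus x y.
Definition kmult (x y : K) : K := mult x y.
Definition kopp (x : K) : K := opp x.

Lemma K_ring_theory :
  ring_theory kzero kone kplus kmult (fun x y => kplus x (kopp y)) kopp eq.
Proof.
  split; unfold kzero, kone, kplus, kmult, kopp; intros.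
  - apply plus_zero_l.
  - apply plus_comm.
  - apply plus_assoc.
  - apply mult_one_l.
  - apply (rc_comm _ _ _ HK).
  - apply mult_assoc.
  - exact (@mult_distr_r K x y z).
  - reflexivity.
  - exact (@plus_opp_r K _).
Qed.
Add Ring K_ring : K_ring_theory.

Ltac kring :=
  match goal with |- @eq _ ?a ?b => change (@eq (AbsRing.sort K) a b) end;
  repeat match goal with
  | |- context [@plus ?G ?a ?b] => change (@plus G a b) with (kplus a b)
  | |- context [@mult ?G ?a ?b] => change (@mult G a b) with (kmult a b)
  | |- context [@opp ?G ?a] => change (@opp G a) with (kopp a)
  | |- context [@zero ?G] => change (@zero G) with kzero
  | |- context [@one ?G] => change (@one G) with kone
  end; ring.

(** * Linear functionals on X and homogeneity of its norm *)

Lemma ofR_zero : ofR 0 = zero.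
Proof. apply abs_eq_zero. rewrite (rc_abs_ofR _ _ _ HK). apply Rabs_R0. Qed.

Lemma ofR_opp t : ofR (- t) = opp (ofR t).
Proof.
  assert (H : plus (ofR (- t)) (ofR t) = zero).
  { rewrite <- (rc_ofR_plus _ _ _ HK), <- ofR_zero. f_equal. ring. }
  transitivity (plus (plus (ofR (- t)) (ofR t)) (opp (ofR t))); [kring|]. rewrite H. kring.
Qed.

Definition vzero : vec K := (fun _ => zero, fun _ => zero).

Lemma c0_zero : is_c0 K (fun _ => zero).
Proof. intros eps He. exists 0%nat. intros. now rewrite abs_zero. Qed.

Lemma inX_vzero : inX K vzero.
Proof. split; apply c0_zero. Qed.

Lemma lin_vzero f : is_lin_functional K f -> f vzero = zero.
Proof.
  intros Hf. pose proof (Hf one vzero vzero inX_vzero inX_vzero) as H.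
  replace (vadd K (vscal K one vzero) vzero) with vzero in H.
  - transitivity (plus (plus (mult one (f vzero)) (f vzero)) (opp (f vzero))); [kring|].
    rewrite <- H. kring.
  - unfold vadd, vscal, vzero. simpl. f_equal; apply functional_extensionality; intro; kring.
Qed.

Lemma lin_scal f a x : is_lin_functional K f -> inX K x -> f (vscal K a x) = mult a (f x).
Proof.
  intros Hf Hx. replace (vscal K a x) with (vadd K (vscal K a x) vzero).
  - rewrite Hf by (trivial; apply inX_vzero). rewrite lin_vzero by trivial. kring.
  - unfold vadd, vscal, vzero. simpl. f_equal; apply functional_extensionality; intro; kring.
Qed.

Lemma inX_vadd_vscal a x y : inX K x -> inX K y -> inX K (vadd K (vscal K a x) y).
Proof.
  intros [Hx1 Hx2] [Hy1 Hy2]. split.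
  - replace (fst (vadd K (vscal K a x) y)) with (fun n => plus (fst y n) (mult a (fst x n))).
    + now apply (c0_affine K ofR ip HK).
    + apply functional_extensionality. intro n. simpl. kring.
  - replace (snd (vadd K (vscal K a x) y)) with (fun n => plus (snd y n) (mult a (snd x n))).
    + now apply (c0_affine K ofR ip HK).
    + apply functional_extensionality. intro n. simpl. kring.
Qed.

Lemma inX_vscal a x : inX K x -> inX K (vscal K a x).
Proof.
  intros Hx. replace (vscal K a x) with (vadd K (vscal K a x) vzero).
  - apply inX_vadd_vscal; [trivial | apply inX_vzero].
  - unfold vadd, vscal, vzero. simpl. f_equal; apply functional_extensionality; intro; kring.
Qed.

Lemma Znorm_scal t z : 0 < t -> is_c0 K z -> Znorm K (fun n => mult (ofR t) (z n)) = t * Znorm K z.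
Proof.
  intros Ht Hz. unfold Znorm. rewrite (supnorm_scal K ofR ip HK) by trivial.
  rewrite Rmult_plus_distr_l. f_equal.
  transitivity (sqrt (t ^ 2 * Series (fun n => abs (z n) ^ 2 / 2 ^ S n)));
    [|rewrite sqrt_mult_alt by apply pow2_ge_0; now rewrite sqrt_pow2 by lra].
  f_equal. rewrite <- Series_scal_l. apply Series_ext. intro n.
  rewrite (abs_ofR_mult K ofR ip HK) by lra. field. apply pow_nonzero. lra.
Qed.

Lemma nX_scal t x : 0 < t -> inX K x -> nX K (vscal K (ofR t) x) = t * nX K x.
Proof.
  intros Ht [H1 H2]. unfold nX, vscal. simpl.
  rewrite (supnorm_scal K ofR ip HK), Znorm_scal by trivial.
  apply RmaxRmult. lra.
Qed.

Lemma nX_ge0 x : inX K x -> 0 <= nX K x.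
Proof.
  intros Hx. eapply Rle_trans; [apply (supnorm_ge0 K (fst x)), Hx | apply Rmax_l].
Qed.

(** The dual norm only tests the unit ball, so [x] is divided by its norm plus [e]. The positive [e]
    avoids division by zero and then tends to 0. *)
Lemma functional_le f x :
  is_lin_functional K f -> dual_norm_is K f 1 -> inX K x -> abs (f x) <= nX K x.
Proof.
  intros Hf [Hub _] Hx. apply le_epsilon. intros e He.
  pose proof (nX_ge0 x Hx) as H0. set (m := nX K x + e).
  assert (Hm : 0 < m) by (unfold m; lra).
  assert (Hi : 0 < / m) by now apply Rinv_0_lt_compat.
  assert (H : abs (f (vscal K (ofR (/ m)) x)) <= 1).
  { apply Hub. exists (vscal K (ofR (/ m)) x). split; [now apply inX_vscal|]. split; [|reflexivity].
    rewrite nX_scal by trivial. apply (Rmult_le_reg_l m); [trivial|].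
    rewrite <- Rmult_assoc, Rinv_r by lra. unfold m. lra. }
  rewrite lin_scal, (abs_ofR_mult K ofR ip HK) in H by (trivial; lra).
  apply (Rmult_le_compat_l m) in H; [|lra].
  rewrite <- Rmult_assoc, Rinv_r in H by lra. lra.
Qed.

(** * Vectors a e_0 + b e_{n+1} and the supporting pairs built from them *)

Definition two_coord (n : nat) (a b : K) : nat -> K :=
  fun m => if Nat.eqb m 0 then a else if Nat.eqb m (S n) then b else zero.

Lemma c0_two_coord n a b : is_c0 K (two_coord n a b).
Proof.
  intros eps He. exists (S (S n)). intros m Hm. unfold two_coord.
  destruct (Nat.eqb_spec m 0); [lia|]. destruct (Nat.eqb_spec m (S n)); [lia|].
  now rewrite abs_zero.
Qed.

Lemma two_coord_0 n a b : two_coord n a b 0%nat = a.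
Proof. reflexivity. Qed.

Lemma two_coord_S n a b : two_coord n a b (S n) = b.
Proof. unfold two_coord. simpl. now rewrite Nat.eqb_refl. Qed.

Lemma supnorm_two_coord n a b : supnorm K (two_coord n a b) <= Rmax (abs a) (abs b).
Proof.
  apply supnorm_le. intro m. unfold two_coord.
  destruct (Nat.eqb m 0); [apply Rmax_l|]. destruct (Nat.eqb m (S n)); [apply Rmax_r|].
  rewrite abs_zero. eapply Rle_trans; [apply (abs_ge_0 a) | apply Rmax_l].
Qed.

Lemma Znorm_two_coord n a b :
  Znorm K (two_coord n a b) <=
  Rmax (abs a) (abs b) + sqrt (abs a ^ 2 / 2 + / 2 ^ S (S n) * abs b ^ 2).
Proof.
  unfold Znorm. apply Rplus_le_compat; [apply supnorm_two_coord|].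
  apply sqrt_le_1_alt.
  assert (H2 : forall j, 0 < / 2 ^ j) by (intro; apply Rinv_0_lt_compat, pow_lt; lra).
  set (w := / 2 ^ S (S n) * abs b ^ 2).
  assert (Hw : 0 <= w) by (apply Rmult_le_pos; [left; apply H2 | apply pow2_ge_0]).
  (* [t j] is the sum of the terms of index at least [j]. *)
  set (t := fun j => if Nat.eqb j 0 then abs a ^ 2 / 2 + w else if Nat.leb j (S n) then w else 0).
  change (abs a ^ 2 / 2 + w) with (t 0%nat). apply Series_le_telescope.
  - intro j. unfold t. pose proof (pow2_ge_0 (abs a)).
    destruct (Nat.eqb j 0); [lra|]. destruct (Nat.leb j (S n)); lra.
  - intro j. unfold t, two_coord. destruct j as [|j].
    + simpl. lra.
    + simpl (Nat.eqb (S j) 0). simpl (Nat.eqb (S (S j)) 0). cbv iota.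
      destruct (Nat.eqb_spec (S j) (S n)) as [->|Hne].
      * rewrite (proj2 (Nat.leb_le (S n) (S n))) by lia.
        rewrite (proj2 (Nat.leb_gt (S (S n)) (S n))) by lia. unfold w, Rdiv. lra.
      * rewrite abs_zero. destruct (Nat.leb_spec (S j) (S n)), (Nat.leb_spec (S (S j)) (S n));
          try lia; unfold Rdiv; rewrite ?pow_i by lia; lra.
  - apply ex_series_sq_weighted with (Rmax (abs a) (abs b)). intro m. split; [apply abs_ge_0|].
    eapply Rle_trans; [apply abs_le_supnorm, c0_two_coord | apply supnorm_two_coord].
Qed.

Lemma Znorm_ge_two_coord n z :
  is_c0 K z -> supnorm K z + sqrt (abs (z 0%nat) ^ 2 / 2 + / 2 ^ S (S n) * abs (z (S n)) ^ 2) <= Znorm K z.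
Proof.
  intros Hz. unfold Znorm. apply Rplus_le_compat_l, sqrt_le_1_alt.
  destruct (c0_bounded K z Hz) as [M HM].
  pose proof (Series_ge_two_terms _ n (sq_weighted_ge0 (fun n => abs (z n)))
    (ex_series_sq_weighted _ M (fun n => conj (abs_ge_0 (z n)) (HM n)))) as H.
  eapply Rle_trans; [|exact H]. right. simpl. field. apply pow_nonzero. lra.
Qed.

(* [test_functional n s] supports the unit ball of [X] at [test_point n s th]: its second component is the
   derivative of the norm of [Z] at [e_0 + s e_(n+1)], whose sup norm is attained at coordinate [0] only. *)
Definition test_point (n : nat) (s : R) (th : K) : vec K :=
  let q := wnorm (/ 2 ^ S (S n)) s in
  (two_coord n one th, two_coord n (ofR (/ (1 + q))) (ofR (s / (1 + q)))).

Definition test_functional (n : nat) (s : R) : vec K -> K :=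
  let k := / 2 ^ S (S n) in let q := wnorm k s in
  fun x => plus (mult (ofR (1 + / (2 * q))) (snd x 0%nat)) (mult (ofR (s * k / q)) (snd x (S n))).

Lemma test_functional_linear n s : is_lin_functional K (test_functional n s).
Proof. intros a x y _ _. unfold test_functional, vadd, vscal. simpl fst; simpl snd. kring. Qed.

(** The summand 1 of the coefficient at e_0 is charged to the sup norm. What remains, (z_0 / 2 + s k
    z_{n+1}) / q, is bounded by the weighted part through Cauchy-Schwarz. *)
Lemma test_functional_le n s x :
  -1 <= s <= 1 -> inX K x -> abs (test_functional n s x) <= nX K x.
Proof.
  intros Hs Hx. eapply Rle_trans; [|apply Znorm_le_nX].
  eapply Rle_trans; [|apply (Znorm_ge_two_coord n), Hx].
  unfold test_functional. pose proof (half_power_bounds (S n)) as Hk.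
  set (k := / 2 ^ S (S n)) in *.
  pose proof (wnorm_bounds k s Hk Hs) as Hb. pose proof (wnorm_sq k s Hk Hs) as Hq.
  set (q := wnorm k s) in *.
  eapply Rle_trans; [apply abs_triangle|]. rewrite !(rc_abs_mult _ _ _ HK), !(rc_abs_ofR _ _ _ HK).
  assert (Hi : 0 < / (2 * q)) by (apply Rinv_0_lt_compat; lra).
  rewrite (Rabs_pos_eq (1 + / (2 * q))) by lra.
  assert (Es : Rabs (s * k / q) = Rabs s * k / q).
  { unfold Rdiv. rewrite !Rabs_mult, (Rabs_pos_eq k), (Rabs_pos_eq (/ q)); try lra.
    left; apply Rinv_0_lt_compat; lra. }
  rewrite Es.
  apply Rle_trans with (abs (snd x 0%nat) +
    (1 * abs (snd x 0%nat) / 2 + Rabs s * k * abs (snd x (S n))) / q).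
  - right. field. lra.
  - apply Rplus_le_compat; [now apply abs_le_supnorm, Hx|].
    apply cauchy_schwarz_weighted; [lra | | lra]. rewrite Hq, pow2_abs. lra.
Qed.

Lemma test_functional_test_point n s th :
  -1 <= s <= 1 -> test_functional n s (test_point n s th) = one.
Proof.
  intros Hs. unfold test_functional, test_point. cbn [snd]. rewrite two_coord_0, two_coord_S.
  rewrite <- !(rc_ofR_mult _ _ _ HK), <- (rc_ofR_plus _ _ _ HK), <- (rc_ofR_one _ _ _ HK). f_equal.
  pose proof (half_power_bounds (S n)) as Hk. set (k := / 2 ^ S (S n)) in *.
  pose proof (wnorm_bounds k s Hk Hs) as Hb. pose proof (wnorm_sq k s Hk Hs) as Hq.
  set (q := wnorm k s) in *.
  transitivity ((q + (1 / 2 + s ^ 2 * k)) / (q * (1 + q))); [field; lra|].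
  rewrite <- Hq. field. lra.
Qed.

(** Since [s] has modulus at most 1, the second component has sup norm 1 / (1 + q) and weighted part
    q / (1 + q). The parameter [th] moves only the first component, whose sup norm stays 1. The
    functional, dominated by the norm and equal to one at the point, gives the lower bounds. *)
Lemma test_inPi n s th :
  -1 <= s <= 1 -> abs th <= 1 -> inPi K (test_point n s th) (test_functional n s).
Proof.
  intros Hs Hth.
  assert (Hx : inX K (test_point n s th)) by (split; apply c0_two_coord).
  pose proof (test_functional_test_point n s th Hs) as Hf.
  assert (Hn : nX K (test_point n s th) = 1).
  { apply Rle_antisym.
    - apply Rmax_lub.
      + eapply Rle_trans; [apply supnorm_two_coord|]. rewrite abs_one. now apply Rmax_lub; lra.
      + eapply Rle_trans; [apply Znorm_two_coord|].
        pose proof (half_power_bounds (S n)) as Hk. set (k := / 2 ^ S (S n)) in *.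
        pose proof (wnorm_bounds k s Hk Hs) as Hb. pose proof (wnorm_sq k s Hk Hs) as Hq.
        set (q := wnorm k s) in *.
        assert (Hi : 0 < / (1 + q)) by (apply Rinv_0_lt_compat; lra).
        rewrite !(rc_abs_ofR _ _ _ HK).
        replace (Rabs (/ (1 + q)) ^ 2 / 2 + k * Rabs (s / (1 + q)) ^ 2) with ((q / (1 + q)) ^ 2).
        * rewrite sqrt_pow2 by (apply Rdiv_le_0_compat; lra).
          rewrite Rmax_left.
          -- rewrite Rabs_pos_eq by lra. right. field. lra.
          -- unfold Rdiv. rewrite Rabs_mult, (Rabs_pos_eq (/ _)) by lra.
             assert (Rabs s <= 1) by (apply Rabs_le; lra). nra.
        * rewrite !pow2_abs. unfold Rdiv. rewrite !Rpow_mult_distr, Hq. field. lra.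
    - rewrite <- (@abs_one K), <- Hf. now apply test_functional_le. }
  split; [trivial|]. split; [trivial|]. split; [apply test_functional_linear|]. split; [|trivial].
  split.
  - intros r [u [Hu [Hu1 ->]]]. eapply Rle_trans; [now apply test_functional_le | trivial].
  - intros b Hb. apply Hb. exists (test_point n s th). rewrite Hf, abs_one. split; [trivial|]. lra.
Qed.

(** * Vanishing of a matrix coefficient *)

Lemma lin_two_coord f n a b c d : is_lin_functional K f ->
  f (two_coord n a b, two_coord n c d) =
  plus (plus (mult a (f (two_coord n one zero, two_coord n zero zero)))
             (mult b (f (two_coord n zero one, two_coord n zero zero))))
       (plus (mult c (f (two_coord n zero zero, two_coord n one zero)))
             (mult d (f (two_coord n zero zero, two_coord n zero one)))).
Proof.
  intros Hf.
  assert (HX : forall a b c d, inX K (two_coord n a b, two_coord n c d))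
    by (intros; split; apply c0_two_coord).
  replace (two_coord n a b, two_coord n c d) with
    (vadd K (vscal K a (two_coord n one zero, two_coord n zero zero))
    (vadd K (vscal K b (two_coord n zero one, two_coord n zero zero))
    (vadd K (vscal K c (two_coord n zero zero, two_coord n one zero))
            (vscal K d (two_coord n zero zero, two_coord n zero one))))).
  - rewrite !Hf, lin_scal by (repeat apply inX_vadd_vscal; try apply inX_vscal; trivial). kring.
  - unfold vadd, vscal, two_coord. simpl. f_equal; apply functional_extensionality; intro m;
      destruct (Nat.eqb m 0), (Nat.eqb m (S n)); kring.
Qed.

Lemma abs_kopp (x : K) : abs (opp x) = abs x.
Proof. apply abs_opp. Qed.

(* Averaging the numerical radius inequality over [(s, th)] and [(-s, -th)] removes all terms of first order in [s]
   except [s * th * r], where [r] is the matrix coefficient below; choosing the phase of [th] forces [r = 0]. *)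
Lemma coefficient_vanishes T n :
  is_op K T -> numrad_is K T 1 ->
  abs (test_functional n 0 (T (test_point n 0 zero))) = 1 ->
  snd (T (two_coord n zero one, two_coord n zero zero)) (S n) = zero.
Proof.
  intros [HTX [HTl _]] [HT _] H1.
  assert (HL : forall j, is_lin_functional K (fun x => snd (T x) j)).
  { intros j a x y Hx Hy. rewrite HTl by trivial. reflexivity. }
  pose proof (fun a b c d => lin_two_coord _ n a b c d (HL 0%nat)) as HE0.
  pose proof (fun a b c d => lin_two_coord _ n a b c d (HL (S n))) as HEn.
  cbv beta in HE0, HEn.
  (* Matrix entries of [T]: [p1] to [p4] lie in the row of coordinate 0 of the second summand, and
     [q1], [r], [q3], [q4] in the row of coordinate n + 1. The columns are e_0 and e_{n+1} of the
     first summand, then of the second. *)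
  set (p1 := snd (T (two_coord n one zero, two_coord n zero zero)) 0%nat) in *.
  set (p2 := snd (T (two_coord n zero one, two_coord n zero zero)) 0%nat) in *.
  set (p3 := snd (T (two_coord n zero zero, two_coord n one zero)) 0%nat) in *.
  set (p4 := snd (T (two_coord n zero zero, two_coord n zero one)) 0%nat) in *.
  set (q1 := snd (T (two_coord n one zero, two_coord n zero zero)) (S n)) in *.
  set (r := snd (T (two_coord n zero one, two_coord n zero zero)) (S n)) in *.
  set (q3 := snd (T (two_coord n zero zero, two_coord n one zero)) (S n)) in *.
  set (q4 := snd (T (two_coord n zero zero, two_coord n zero one)) (S n)) in *.
  assert (HF : forall s th, -1 <= s <= 1 -> abs th <= 1 ->
    abs (test_functional n s (T (test_point n s th))) <= 1).
  { intros s th Hs Hth. apply HT. exists (test_point n s th), (test_functional n s).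
    split; [now apply test_inPi | reflexivity]. }
  pose proof (half_power_bounds (S n)) as Hk.
  unfold test_functional, test_point in H1, HF. cbv zeta in H1, HF.
  set (k := / 2 ^ S (S n)) in *.
  rewrite HE0, HEn in H1.
  assert (HF' : forall s th, -1 <= s <= 1 -> abs th <= 1 ->
    abs (plus (mult (ofR (1 + / (2 * wnorm k s)))
            (plus (plus (mult one p1) (mult th p2))
              (plus (mult (ofR (/ (1 + wnorm k s))) p3) (mult (ofR (s / (1 + wnorm k s))) p4))))
          (mult (ofR (s * k / wnorm k s))
            (plus (plus (mult one q1) (mult th r))
              (plus (mult (ofR (/ (1 + wnorm k s))) q3) (mult (ofR (s / (1 + wnorm k s))) q4))))) <= 1).
  { intros s th Hs Hth. generalize (HF s th Hs Hth). rewrite HE0, HEn. trivial. }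
  clear HF HE0 HEn HL.
  (* [w] is the value at s = 0, th = 0. There the coefficient of [p3] is a product equal to one. *)
  set (w := plus (mult (ofR (1 + / (2 * wnorm k 0))) p1) p3).
  assert (Hw : abs w = 1).
  { rewrite <- H1. f_equal. unfold w.
    replace (0 / (1 + wnorm k 0)) with 0 by (unfold Rdiv; ring).
    replace (0 * k / wnorm k 0) with 0 by (unfold Rdiv; ring).
    rewrite ofR_zero.
    assert (E : mult (ofR (1 + / (2 * wnorm k 0))) (ofR (/ (1 + wnorm k 0))) = one).
    { rewrite <- (rc_ofR_mult _ _ _ HK), <- (rc_ofR_one _ _ _ HK). f_equal.
      pose proof (support_ratio_deviation k 0 Hk ltac:(lra)) as H.
      change ((1 + / (2 * wnorm k 0)) / (1 + wnorm k 0) = 1).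
      generalize (Rabs_pos ((1 + / (2 * wnorm k 0)) / (1 + wnorm k 0) - 1)). intros.
      apply Rminus_diag_uniq, Rabs_eq_0. lra. }
    transitivity (plus (mult (ofR (1 + / (2 * wnorm k 0))) p1)
      (mult (mult (ofR (1 + / (2 * wnorm k 0))) (ofR (/ (1 + wnorm k 0)))) p3)); [rewrite E|]; kring. }
  (* The terms in [p2], [p4], [q1] and [q3] are odd in (s, th) and cancel. *)
  assert (Havg : forall s th, -1 <= s <= 1 -> abs th <= 1 ->
    abs (plus (plus (mult (ofR (1 + / (2 * wnorm k s))) p1)
                (mult (ofR ((1 + / (2 * wnorm k s)) / (1 + wnorm k s))) p3))
         (plus (mult (ofR (s * k / wnorm k s)) (mult th r))
               (mult (ofR (s * k / wnorm k s * (s / (1 + wnorm k s)))) q4))) <= 1).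
  { intros s th Hs Hth.
    generalize (HF' s th Hs Hth) (HF' (- s) (opp th) ltac:(lra)
      ltac:(rewrite abs_kopp; exact Hth)).
    replace (wnorm k (- s)) with (wnorm k s) by (unfold wnorm; f_equal; ring).
    replace (- s * k / wnorm k s) with (- (s * k / wnorm k s)) by (unfold Rdiv; ring).
    replace (- s / (1 + wnorm k s)) with (- (s / (1 + wnorm k s))) by (unfold Rdiv; ring).
    rewrite !ofR_opp. intros h1 h2.
    apply (Rmult_le_reg_l 2); [lra|]. rewrite <- (abs_ofR_mult K ofR ip HK) by lra.
    rewrite Rmult_1_r. eapply Rle_trans; [|exact (Rplus_le_compat _ _ _ _ h1 h2)].
    eapply Rle_trans; [|apply abs_triangle]. right. f_equal.
    rewrite (rc_ofR_mult _ _ _ HK (s * k / wnorm k s)).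
    unfold Rdiv at 1. rewrite (rc_ofR_mult _ _ _ HK (1 + / (2 * wnorm k s))).
    replace (ofR 2) with (plus one one : K)
      by (rewrite <- (rc_ofR_one _ _ _ HK), <- (rc_ofR_plus _ _ _ HK); f_equal; ring).
    kring. }
  clear HF' H1.
  apply NNPP. intros Hr.
  destruct (rc_inv _ _ _ HK r Hr) as [y Hy].
  pose proof (abs_gt_0 r Hr) as Hr0.
  assert (Hyr : abs y * abs r = 1) by (rewrite <- (rc_abs_mult _ _ _ HK), Hy; apply abs_one).
  (* As [y] inverts [r], this choice makes th r equal to abs r times [w], so the first order term
     points in the direction of [w]. *)
  set (th := mult (ofR (abs r)) (mult w y)).
  assert (Hth : abs th <= 1).
  { unfold th. rewrite (abs_ofR_mult K ofR ip HK) by lra. rewrite (rc_abs_mult _ _ _ HK), Hw. lra. }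
  assert (Ethr : mult th r = mult (ofR (abs r)) w).
  { unfold th. transitivity (mult (mult (ofR (abs r)) w) (mult y r)); [kring|]. rewrite Hy. kring. }
  set (C := abs p1 + abs p3 + abs q4).
  assert (HC : 0 <= C) by (unfold C; generalize (abs_ge_0 p1) (abs_ge_0 p3) (abs_ge_0 q4); lra).
  assert (Hkr : 0 < k * abs r) by (apply Rmult_lt_0_compat; lra).
  assert (Hmain : forall s, 0 < s <= 1 -> k * abs r <= s * C).
  { intros s Hs. assert (Hs' : -1 <= s <= 1) by lra.
    generalize (Havg s th Hs' Hth). rewrite Ethr.
    generalize (wnorm_deviation k s Hk Hs') (support_ratio_deviation k s Hk Hs')
      (cross_term_bound k s Hk Hs') (wnorm_bounds k s Hk Hs').
    set (q := wnorm k s). intros B1 B2 B3 Hq.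
    set (d := s * k / q) in *. set (rho := (1 + / (2 * q)) / (1 + q)) in *.
    set (g := d * (s / (1 + q))) in *.
    set (c := / (2 * q)) in *. set (c0 := / (2 * wnorm k 0)) in *.
    intros Hav.
    assert (Hd : s * k <= d).
    { apply (Rmult_le_reg_r q); [lra|]. replace (d * q) with (s * k * 1) by (unfold d; field; lra).
      apply Rmult_le_compat_l; [apply Rmult_le_pos|]; lra. }
    (* The averaged value minus its second order deviations is exactly (1 + d abs r) w. With [d] at
       least s k, comparing moduli gives s k abs r <= s^2 C. *)
    assert (H : abs (mult (ofR (1 + d * abs r)) w) <= 1 + s ^ 2 * C).
    { transitivity (abs (plus
        (plus (plus (mult (ofR (1 + c)) p1) (mult (ofR rho) p3))
          (plus (mult (ofR d) (mult (ofR (abs r)) w)) (mult (ofR g) q4)))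
        (opp (plus (plus (mult (ofR (c - c0)) p1) (mult (ofR (rho - 1)) p3)) (mult (ofR g) q4))))).
      - right. f_equal. unfold w. unfold Rminus.
        rewrite !(rc_ofR_plus _ _ _ HK), !ofR_opp, (rc_ofR_mult _ _ _ HK d), (rc_ofR_one _ _ _ HK).
        kring.
      - eapply Rle_trans; [apply abs_triangle|]. apply Rplus_le_compat; [exact Hav|].
        rewrite abs_kopp.
        eapply Rle_trans; [apply abs_triangle|].
        eapply Rle_trans; [apply Rplus_le_compat_r, abs_triangle|].
        rewrite !(rc_abs_mult _ _ _ HK), !(rc_abs_ofR _ _ _ HK).
        unfold C. rewrite !Rmult_plus_distr_l.
        repeat apply Rplus_le_compat; apply Rmult_le_compat_r; trivial; apply abs_ge_0. }
    assert (0 <= s * k) by nra.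
    rewrite (abs_ofR_mult K ofR ip HK), Hw in H by nra.
    assert (s * (k * abs r) <= s * (s * C)) by nra.
    apply (Rmult_le_reg_l s); lra. }
  (* This [s] lies in (0, 1] and satisfies s C < k abs r, contradicting [Hmain]. *)
  specialize (Hmain (k * abs r / (C + 1 + k * abs r))).
  assert (Hden : 0 < C + 1 + k * abs r) by lra.
  assert (Hs1 : k * abs r / (C + 1 + k * abs r) <= 1) by (apply Rle_div_l; lra).
  assert (Hs0 : 0 < k * abs r / (C + 1 + k * abs r)) by now apply Rdiv_lt_0_compat.
  specialize (Hmain (conj Hs0 Hs1)).
  apply (Rmult_le_compat_r (C + 1 + k * abs r)) in Hmain; [|lra].
  replace (k * abs r / (C + 1 + k * abs r) * C * (C + 1 + k * abs r)) with (k * abs r * C) in Hmain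
    by (field; lra).
  nra.
Qed.

(** * Operators whose numerical radius is almost attained at the base pair *)

Definition diag_op (c : R) (n : nat) (x : vec K) : vec K :=
  (fun _ => zero,
   fun m => if orb (Nat.eqb m 0) (Nat.leb (S n) m) then mult (ofR c) (fst x m) else (zero : K)).

Lemma diag_op_le c n x m : 0 <= c -> abs (snd (diag_op c n x) m) <= c * abs (fst x m).
Proof.
  intros Hc. simpl snd. destruct (orb _ _).
  - rewrite (abs_ofR_mult K ofR ip HK) by trivial. lra.
  - rewrite abs_zero. apply Rmult_le_pos; [trivial | apply abs_ge_0].
Qed.

Lemma inX_diag_op c n x : 0 <= c -> inX K x -> inX K (diag_op c n x).
Proof.
  intros Hc [Hx _]. split; [apply c0_zero|]. intros eps He.
  destruct (Hx (eps / (c + 1))) as [N HN]; [apply Rdiv_lt_0_compat; lra|].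
  exists N. intros m Hm. specialize (HN m Hm).
  eapply Rle_lt_trans; [now apply diag_op_le|].
  pose proof (abs_ge_0 (fst x m)).
  apply Rle_lt_trans with ((c + 1) * abs (fst x m)); [nra|].
  replace eps with ((c + 1) * (eps / (c + 1))) by (field; lra). apply Rmult_lt_compat_l; lra.
Qed.

Lemma diag_op_is_op c n : 0 <= c -> is_op K (diag_op c n).
Proof.
  intros Hc. split; [intros; now apply inX_diag_op|]. split.
  - intros a x y _ _. unfold diag_op, vadd, vscal. simpl.
    f_equal; apply functional_extensionality; intro m; [|destruct (orb _ _)]; kring.
  - exists (2 * c). intros x Hx.
    assert (H : 0 <= 2 * (c * nX K x)) by (generalize (nX_ge0 x Hx); nra).
    rewrite Rmult_assoc. apply Rmax_lub.
    + eapply Rle_trans; [apply supnorm_le with (M := 0); intro; simpl; rewrite abs_zero|]; lra.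
    + apply Znorm_le. intro m. eapply Rle_trans; [now apply diag_op_le|].
      apply Rmult_le_compat_l; [trivial | now apply abs_fst_le_nX].
Qed.

(** The surviving coordinates are 0, of weight 1/2, and those beyond [n], whose weights sum to
    2^-(n+1). *)
Lemma nX_diag_op n x :
  inX K x -> nX K x <= 1 -> nX K (diag_op 1 n x) <= 1 + sqrt (1 / 2 + / 2 ^ S n).
Proof.
  intros Hx H1.
  assert (H2 : forall j, 0 < / 2 ^ j) by (intro; apply Rinv_0_lt_compat, pow_lt; lra).
  assert (Hm : forall m, abs (snd (diag_op 1 n x) m) <= 1).
  { intro m. eapply Rle_trans; [apply diag_op_le; lra|]. rewrite Rmult_1_l.
    eapply Rle_trans; [now apply abs_fst_le_nX | trivial]. }
  pose proof (sqrt_pos (1 / 2 + / 2 ^ S n)) as Hs.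
  apply Rmax_lub.
  - eapply Rle_trans; [apply supnorm_le with (M := 0); intro; simpl; rewrite abs_zero|]; lra.
  - unfold Znorm. apply Rplus_le_compat; [now apply supnorm_le|].
    apply sqrt_le_1_alt.
    (* [t j] is the total weight of the surviving coordinates of index at least [j]. *)
    set (t := fun j => if Nat.eqb j 0 then 1 / 2 + / 2 ^ S n
                       else if Nat.leb j n then / 2 ^ S n else / 2 ^ j).
    change (1 / 2 + / 2 ^ S n) with (t 0%nat). apply Series_le_telescope.
    + intro j. unfold t. generalize (H2 (S n)) (H2 j). intros.
      destruct (Nat.eqb j 0); [lra|]. destruct (Nat.leb j n); lra.
    + intro j. specialize (Hm j). pose proof (abs_ge_0 (snd (diag_op 1 n x) j)) as H0.
      assert (Hsq : abs (snd (diag_op 1 n x) j) ^ 2 / 2 ^ S j <= / 2 ^ S j).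
      { unfold Rdiv. rewrite <- (Rmult_1_l (/ 2 ^ S j)) at 2.
        apply Rmult_le_compat_r; [left; apply H2 | nra]. }
      assert (Hhalf : / 2 ^ S j = / 2 ^ j / 2) by (simpl; field; apply pow_nonzero; lra).
      unfold t. destruct j as [|j].
      * change (Nat.eqb 0 0) with true. change (Nat.eqb 1 0) with false. cbv iota.
        rewrite pow_1 in Hsq. destruct n as [|n']; simpl Nat.leb; cbv iota; rewrite ?pow_1 in *; lra.
      * change (Nat.eqb (S j) 0) with false. change (Nat.eqb (S (S j)) 0) with false. cbv iota.
        destruct (Nat.leb_spec (S j) n) as [Hj|Hj].
        -- assert (E : snd (diag_op 1 n x) (S j) = zero).
           { unfold diag_op. cbn [snd]. change (Nat.eqb (S j) 0) with false.
             now rewrite (proj2 (Nat.leb_gt (S n) (S j))) by lia. }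
           rewrite E, abs_zero. rewrite pow_i by lia. unfold Rdiv. rewrite Rmult_0_l.
           destruct (Nat.leb_spec (S (S j)) n); [lra|].
           replace (S (S j)) with (S n) by lia. lra.
        -- rewrite (proj2 (Nat.leb_gt (S (S j)) n)) by lia. lra.
    + apply ex_series_sq_weighted with 1. intro m. split; [apply abs_ge_0 | apply Hm].
Qed.

Lemma sqrt_half_plus_le e : 0 <= e -> sqrt (1 / 2 + e) <= sqrt (1 / 2) + e.
Proof.
  intros He. pose proof (sqrt_pos (1 / 2)) as H0.
  rewrite <- (sqrt_pow2 (sqrt (1 / 2) + e)) by lra. apply sqrt_le_1_alt.
  assert (H : sqrt (1 / 2) ^ 2 = 1 / 2) by (apply pow2_sqrt; lra). nra.
Qed.

(** The base pair is independent of [n]. This is essential because [eta] is obtained for a fixed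
    pair before [n] is chosen. *)
Lemma test_pair_0 n :
  test_point n 0 zero = test_point 0 0 zero /\ test_functional n 0 = test_functional 0 0.
Proof.
  assert (E : forall j, wnorm (/ 2 ^ S (S j)) 0 = sqrt (1 / 2)) by
    (intro; unfold wnorm; f_equal; ring).
  assert (Z : forall t, 0 / t = 0) by (intro; unfold Rdiv; ring).
  split.
  - unfold test_point. rewrite !E, !Z, ofR_zero. unfold two_coord.
    f_equal; apply functional_extensionality; intro m;
      destruct (Nat.eqb m 0), (Nat.eqb m (S n)), (Nat.eqb m 1); reflexivity.
  - apply functional_extensionality. intro x. unfold test_functional. rewrite !E.
    rewrite !(Rmult_0_l (/ _)), !Z, ofR_zero. kring.
Qed.

Lemma not_Lpp_nu_X : ~ Lpp_nu K.
Proof.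
  intros H.
  assert (Hz : abs (zero : K) <= 1) by (rewrite abs_zero; lra).
  pose proof (test_inPi 0 0 zero ltac:(lra) Hz) as Hpi.
  destruct (H (1 / 4) ltac:(lra) _ _ Hpi) as [eta [Heta HS]]. clear H.
  (* Choose [n] with 2^-(n+1) below [eta]. *)
  destruct (pow_lt_1_zero (/ 2) ltac:(rewrite Rabs_pos_eq; lra) eta Heta) as [n Hn].
  specialize (Hn (S n) ltac:(lia)).
  pose proof (half_power_bounds n) as Hk.
  rewrite pow_inv, Rabs_pos_eq in Hn by lra. set (e := / 2 ^ S n) in *.
  destruct (test_pair_0 n) as [Ex Ef]. rewrite <- Ex, <- Ef in *. clear Ex Ef.
  set (q0 := sqrt (1 / 2)).
  assert (Eq : wnorm (/ 2 ^ S (S n)) 0 = q0) by (unfold q0, wnorm; f_equal; ring).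
  assert (Hq : 7 / 10 <= q0 <= 1)
    by (rewrite <- Eq; apply wnorm_bounds; [apply half_power_bounds | lra]).
  assert (Hqq : / (2 * q0) = q0).
  { assert (Hq2 : q0 ^ 2 = 1 / 2) by (apply pow2_sqrt; lra).
    apply (Rmult_eq_reg_l (2 * q0)); [|lra]. rewrite Rinv_r by lra. lra. }
  assert (Hle : forall x f, inPi K x f -> abs (f (diag_op 1 n x)) <= 1 + q0 + e).
  { intros x f [Hx [Hx1 [Hf [Hf1 _]]]].
    eapply Rle_trans; [apply functional_le; trivial; apply inX_diag_op; trivial; lra|].
    eapply Rle_trans; [apply nX_diag_op; trivial; lra|].
    generalize (sqrt_half_plus_le e). fold q0. fold e. lra. }
  assert (Hval : forall c, 0 <= c ->
    abs (test_functional n 0 (diag_op c n (test_point n 0 zero))) = (1 + q0) * c).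
  { intros c Hc. unfold test_functional, test_point, diag_op. cbv zeta. rewrite Eq, Hqq.
    cbn [fst snd]. change (orb (Nat.eqb 0 0) (Nat.leb (S n) 0)) with true. cbv iota.
    rewrite two_coord_0, two_coord_S.
    transitivity (abs (mult (ofR (1 + q0)) (mult (ofR c) one))).
    - f_equal. destruct (orb _ _); kring.
    - rewrite !(abs_ofR_mult K ofR ip HK), abs_one by lra. ring. }
  (* [v] is the numerical radius of the unnormalized operator. It lies between 1 + q0, attained at
     the base pair, and 1 + q0 + e. *)
  destruct (completeness (fun r => exists x f, inPi K x f /\ r = abs (f (diag_op 1 n x))))
    as [v [Hub Hlub]].
  { exists (1 + q0 + e). intros r [x [f [Hxf ->]]]. now apply Hle. }
  { eexists. exists (test_point n 0 zero), (test_functional n 0). split; [exact Hpi | reflexivity]. }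
  assert (Hv1 : 1 + q0 <= v).
  { rewrite <- (Rmult_1_r (1 + q0)), <- Hval by lra. apply Hub.
    exists (test_point n 0 zero), (test_functional n 0). split; [exact Hpi | reflexivity]. }
  assert (Hv2 : v <= 1 + q0 + e).
  { apply Hlub. intros r [x [f [Hxf ->]]]. now apply Hle. }
  assert (Hi : 0 < / v) by (apply Rinv_0_lt_compat; lra).
  assert (Hiv : / v * v = 1) by (apply Rinv_l; lra).
  assert (Hscal : forall x f, inPi K x f ->
    abs (f (diag_op (/ v) n x)) = / v * abs (f (diag_op 1 n x))).
  { intros x f [Hx [_ [Hf _]]].
    rewrite <- (abs_ofR_mult K ofR ip HK) by lra.
    rewrite <- lin_scal by (trivial; apply inX_diag_op; trivial; lra).
    do 2 f_equal. unfold diag_op, vscal. cbn [fst snd]. rewrite (rc_ofR_one _ _ _ HK).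
    f_equal; apply functional_extensionality; intro m; [|destruct (orb _ _)]; kring. }
  assert (Hnum : numrad_is K (diag_op (/ v) n) 1).
  { split.
    - intros r [x [f [Hxf ->]]]. rewrite Hscal by trivial. apply Rle_trans with (/ v * v); [|lra].
      apply Rmult_le_compat_l; [lra|]. apply Hub. now exists x, f.
    - intros b Hb.
      assert (v <= v * b).
      { apply Hlub. intros r [x [f [Hxf ->]]].
        apply (Rmult_le_reg_l (/ v)); [trivial|]. rewrite <- Hscal by trivial.
        rewrite <- Rmult_assoc, Hiv, Rmult_1_l. apply Hb. now exists x, f. }
      apply (Rmult_le_reg_l v); lra. }
  destruct (HS (diag_op (/ v) n) (diag_op_is_op (/ v) n ltac:(lra)) Hnum)
    as [S [HSop [HSnum [HS1 [c [[Hc _] Hc4]]]]]].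
  (* The value (1 + q0) / v is at least 1 - e / v, which exceeds 1 - eta because e < eta and v >=
     1. *)
  { rewrite Hval by lra. apply Rlt_gt. apply (Rmult_lt_reg_r v); [lra|].
    rewrite Rmult_assoc, Hiv. destruct (Rle_dec eta 1); nra. }
  pose proof (coefficient_vanishes S n HSop HSnum HS1) as H0.
  (* At this unit vector the coefficient of [S] vanishes and that of the operator is 1 / v. Since v
     < 4, the distance exceeds 1/4. *)
  set (u := (two_coord n zero one, two_coord n zero zero)) in *.
  assert (Hu : inX K u) by (split; apply c0_two_coord).
  assert (Hu1 : nX K u <= 1).
  { apply Rmax_lub; unfold u; cbn [fst snd].
    - eapply Rle_trans; [apply supnorm_two_coord|]. rewrite abs_zero, abs_one. apply Rmax_lub; lra.
    - eapply Rle_trans; [apply Znorm_le with (B := 0)|lra]. intro m. unfold two_coord.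
      destruct (Nat.eqb m 0); [|destruct (Nat.eqb m _)]; rewrite abs_zero; lra. }
  assert (Hdiff : nX K (vsub K (S u) (diag_op (/ v) n u)) <= c).
  { apply Hc. now exists u. }
  assert (HX : inX K (vsub K (S u) (diag_op (/ v) n u))).
  { replace (vsub K (S u) (diag_op (/ v) n u))
      with (vadd K (vscal K (opp one) (diag_op (/ v) n u)) (S u)).
    - apply inX_vadd_vscal; [apply inX_diag_op; trivial; lra | now apply HSop].
    - unfold vsub, vadd. f_equal; apply functional_extensionality; intro; kring. }
  pose proof (abs_snd_le_nX K _ (Datatypes.S n) HX) as Hco.
  assert (E : abs (snd (vsub K (S u) (diag_op (/ v) n u)) (Datatypes.S n)) = / v).
  { unfold vsub, vadd, vscal. cbn [snd]. rewrite H0. unfold diag_op, u. cbn [fst snd].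
    rewrite two_coord_S, Nat.leb_refl, Bool.orb_true_r.
    transitivity (abs (opp (mult (ofR (/ v)) one) : K)); [f_equal; kring|].
    rewrite abs_kopp, (abs_ofR_mult K ofR ip HK), abs_one by lra. ring. }
  rewrite E in Hco.
  assert (v < 4) by lra. nra.
Qed.

End Counterexample.

Theorem theorem3p11 :
  (norm_SSD R_AbsRing (fun t : R => t) /\ ~ Lpp_nu R_AbsRing) /\
  (norm_SSD C_AbsRing RtoC /\ ~ Lpp_nu C_AbsRing).
Proof.
  repeat split.
  - exact (norm_SSD_X _ _ _ real_real_or_complex).
  - exact (not_Lpp_nu_X _ _ _ real_real_or_complex).
  - exact (norm_SSD_X _ _ _ complex_real_or_complex).
  - exact (not_Lpp_nu_X _ _ _ complex_real_or_complex).
Qed.
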